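(* Let $q$ be a power of a prime $p$, $k=\mathbb{F}_q(t)$, and $S=\{D_1,\dots,D_l\}$ a finite set of nonconstant elements of $k$ such that $K=k(\alpha_1,\dots,\alpha_l)$, with $\alpha_i^p-\alpha_i=D_i$, is a geometric extension of $k$ (full constant field $\mathbb{F}_q$). Let $\gamma_S$ be the cardinality of $$\{(a_1,\dots,a_l)\in\mathbb{F}_p^l \mid a_1D_1+\cdots+a_lD_l=F^p-F \text{ for some } F\in k\}.$$ Let $\mathscr{M}$ be the set of monic irreducible $P\in\mathbb{F}_q[t]$ with $\mathrm{ord}_P(D_i)\ge0$ for all $i$ and $\{\frac{D_1}{P}\}=\cdots=\{\frac{D_l}{P}\}=0$. Then the relative density of $\mathscr{M}$ exists and equals $\gamma_S/p^l$.
   Context: For monic irreducible $P$ and $D\in k$ with $\mathrm{ord}_P(D)\ge0$, the Hasse symbol is $\{\frac{D}{P}\}=\mathrm{tr}_{\mathbb{F}_q/\mathbb{F}_p}\mathrm{tr}_{(\mathbb{F}_q[t]/P)/\mathbb{F}_q}(D\bmod P)\in\mathbb{F}_p$. A set $T$ of monic irreducible polynomials has relative density $\varepsilon$ if $\lim_{N\to\infty}\#\{P\in T:\deg P=N\}/\pi(N)=\varepsilon$, where $\pi(N)$ is the number of monic irreducible polynomials of degree $N$. *)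

(* Defs.v *)
From mathcomp Require Import all_boot all_order all_algebra.
From mathcomp Require Import falgebra fieldext finfield qfpoly.
From mathcomp Require Import all_classical all_reals all_analysis.

Set Implicit Arguments.
Unset Strict Implicit.
Unset Printing Implicit Defensive.

Import Order.TTheory GRing.Theory Num.Theory.
Import numFieldNormedType.Exports.

Local Open Scope classical_set_scope.
Local Open Scope ring_scope.

Notation ratfun F := {fraction {poly F}}.

Definition ratconst (F : fieldType) (c : F) : ratfun F := FracField.tofrac c%:P.

(* The representative chosen by [repr] need not be in lowest terms; dividing
   by the gcd yields a reduced fraction. *)
Definition fracnum (F : fieldType) (x : ratfun F) : {poly F} :=
  let r := repr x in (frac r).1 %/ gcdp (frac r).1 (frac r).2.

Definition fracden (F : fieldType) (x : ratfun F) : {poly F} :=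
  let r := repr x in (frac r).2 %/ gcdp (frac r).1 (frac r).2.

(* The bound on [m] loses nothing: if [f] is nonzero and [P] nonconstant, then
   [P ^+ m %| f] forces [m < size f]. *)
Definition poly_ord (F : fieldType) (P f : {poly F}) : nat :=
  (\max_(m < size f | (P ^+ m %| f)%R) m)%N.

Definition ratfun_ord (F : fieldType) (P : {poly F}) (x : ratfun F) : \bar int :=
  if x == 0 then +oo%E
  else ((poly_ord P (fracnum x))%:Z - (poly_ord P (fracden x))%:Z)%:E.

(* [x] mod [P]; meaningful when [ratfun_ord P x] is nonnegative, so that
   [fracden x] is invertible modulo [P]. *)
Definition residue (F : fieldType) (P : {poly F})
    (hP : monic_irreducible_poly P) (x : ratfun F) : {poly %/ P with hP} :=
  let red (f : {poly F}) : {poly %/ P with hP} := in_qpoly P f in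
  red (fracnum x) / red (fracden x).

(* The trace of [a] is that of the K-linear map "multiplication by [a]"; it
   does not depend on the basis. *)
Definition alg_trace (K : fieldType) (A : falgType K) (a : A) : K :=
  let b := vbasis (fullv : {vspace A}) in \tr (passmx.mxof b b (amulr a)).

(* [pPrimeCharType hp] is [F] viewed as an algebra over ['F_p]. *)
Definition hasse (p : nat) (F : finFieldType) (hp : p \in [pchar F])
    (P : {poly F}) (hP : monic_irreducible_poly P) (x : ratfun F) : 'F_p :=
  @alg_trace 'F_p (pPrimeCharType hp)
    (@alg_trace F {poly %/ P with hP} (residue hP x)).

Definition count_deg (F : finFieldType) (T : set {poly F}) (N : nat) : nat :=
  #|[pred f : {poly_N.+1 F} | `[< T (val f) /\ size (val f) = N.+1 >]]|.

Definition relative_density (R : realType) (F : finFieldType)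
    (T : set {poly F}) (e : R) : Prop :=
  (count_deg T N)%:R / (count_deg (@monic_irreducible_poly F) N)%:R
    @[N --> \oo] --> e.

Definition constant_in (F : fieldType) (K : fieldExtType (ratfun F)) (c : F) :
  K := (ratconst c)%:A.

(* The full constant field of [K] is [F]. *)
Definition geometric_ext (F : fieldType) (K : fieldExtType (ratfun F)) : Prop :=
  forall x : K, algebraicOver (@constant_in F K) x ->
    exists c : F, x = constant_in K c.

Section Family.
Variables (p : nat) (F : finFieldType) (l : nat) (D : 'I_l -> ratfun F).

Definition gammaS : nat :=
  #|[pred a : {ffun 'I_l -> 'F_p} |
      `[< exists f : ratfun F,
            \sum_(i < l) (a i)%:R * D i = f ^+ p - f >]]|.

Definition zero_hasse_set (hp : p \in [pchar F]) : set {poly F} :=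
  [set P | exists hP : monic_irreducible_poly P,
             (forall i, (0 <= ratfun_ord P (D i))%E) /\
             (forall i, hasse hp hP (D i) = 0)].

End Family.

(* Main.v *)
(** For [v] in F_p^l, [p * #{a | a.v = 0} = p^l + (p - 1) p^l [v = 0]]. Applied to
    the vector of Hasse symbols of the [D i] at [P], this reduces the density to
    that of the primes where the symbol of [x = \sum_i a_i D_i] vanishes, for each
    [a]. If [x = f^p - f], these are almost all primes. Otherwise [x] is not even of
    the form [f^p - f + c], because the extension is geometric, and every value [c]
    of the symbol has density [1/p]. It is enough to bound each of these densities
    from above, since the [p] values exhaust the primes.

    The upper bound is obtained by Stepanov's method. Modulo [f^p - f], [x] is a
    fraction [A/B] with a pole of order prime to [p]. The symbol of [A/B] at [P] of
    degree [N] is the sum of the conjugates [(A/B)^(p^i)] in the residue field, and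
    splitting the sum in two parts turns the equation for a given symbol into an algebraic
    relation of low degree. By linear algebra there is a polynomial of degree
    [q^N/p (1 + o(1))] that vanishes modulo every [P] where the relation holds; the
    pole of order prime to [p] forces it to be nonzero. *)

From HB Require Import structures.
Require Import Defs.
From mathcomp Require Import all_boot all_order all_algebra.
From mathcomp Require Import falgebra fieldext finfield qfpoly.
From mathcomp Require Import all_classical all_reals all_analysis.
From mathcomp Require Import qpoly zify ring lra.

Set Implicit Arguments.
Unset Strict Implicit.
Unset Printing Implicit Defensive.

Import Order.TTheory GRing.Theory Num.Theory.
Import numFieldNormedType.Exports.
Local Open Scope ring_scope.

(** * Frobenius sums and traces *)

Section FrobeniusSums.
Variables (R : comNzRingType) (p : nat).
Hypothesis hp : p \in [pchar R].

Let p_pr : prime p. Proof. exact: pcharf_prime hp. Qed.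

Lemma pchar_expn_nat i : [pchar R].-nat (p ^ i)%N.
Proof.
rewrite pnatX; apply/orP; left.
by rewrite (pnatE _ p_pr).
Qed.

Lemma exprpDn i (x y : R) : (x + y) ^+ (p ^ i) = x ^+ (p ^ i) + y ^+ (p ^ i).
Proof. exact: exprDn_pchar (pchar_expn_nat i). Qed.

Lemma expr0p i : (0 : R) ^+ (p ^ i) = 0.
Proof. by rewrite expr0n expn_eq0 -leqn0 leqNgt prime_gt0. Qed.

Lemma exprp_sum i (I : Type) (r : seq I) (P : pred I) (E : I -> R) :
  (\sum_(j <- r | P j) E j) ^+ (p ^ i) = \sum_(j <- r | P j) E j ^+ (p ^ i).
Proof. exact: (big_morph (fun x => x ^+ (p ^ i)) (exprpDn i) (expr0p i)). Qed.

Lemma exprpN i (x : R) : (- x) ^+ (p ^ i) = - x ^+ (p ^ i).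
Proof.
by apply/eqP; rewrite -subr_eq0 opprK -exprpDn addNr expr0p.
Qed.

Lemma exprp_nat i n : (n%:R : R) ^+ (p ^ i) = n%:R.
Proof.
elim: n => [|n IH]; first exact: expr0p.
by rewrite -natr1 exprpDn IH expr1n.
Qed.

(** On a field with [p ^ n] elements this is the absolute trace. *)
Definition frobsum n (x : R) := \sum_(i < n) x ^+ (p ^ i).

Lemma frobsumD n x y : frobsum n (x + y) = frobsum n x + frobsum n y.
Proof. by rewrite /frobsum -big_split /=; apply: eq_bigr => i _; rewrite exprpDn. Qed.

Lemma frobsum0 n : frobsum n 0 = 0.
Proof. by rewrite /frobsum big1 // => i _; rewrite expr0p. Qed.

Lemma frobsum_split m n x :
  frobsum (m + n) x = frobsum m x + frobsum n x ^+ (p ^ m).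
Proof.
rewrite /frobsum big_split_ord /= exprp_sum; congr (_ + _).
by apply: eq_bigr => i _; rewrite -exprM -expnD addnC.
Qed.

(** The sum telescopes. On a field with [p ^ n] elements it vanishes, which makes the symbol of
    [f ^+ p - f] trivial. *)
Lemma frobsum_artin_schreier n x : frobsum n (x ^+ p - x) = x ^+ (p ^ n) - x.
Proof.
elim: n => [|n IH]; first by rewrite /frobsum big_ord0 expr1 subrr.
rewrite -addn1 frobsum_split IH /frobsum big_ord1 expr1 exprpDn exprpN.
by rewrite -exprM addn1 expnS addrC subrKA.
Qed.

Lemma frobsum_natM n m x : frobsum n (m%:R * x) = m%:R * frobsum n x.
Proof.
by rewrite /frobsum mulr_sumr; apply: eq_bigr => i _; rewrite exprMn exprp_nat.
Qed.

Lemma frobsum_sum n (I : Type) (r : seq I) (P : pred I) (E : I -> R) :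
  frobsum n (\sum_(j <- r | P j) E j) = \sum_(j <- r | P j) frobsum n (E j).
Proof. exact: (big_morph _ (frobsumD n) (frobsum0 n)). Qed.

(** Transitivity of the trace: on the field with [p ^ (m * n)] elements, the inner sum is the trace
    to the subfield with [p ^ m] elements. *)
Lemma frobsum_mul m n x :
  frobsum (m * n) x = frobsum m (\sum_(i < n) x ^+ (p ^ (m * i))).
Proof.
elim: n => [|n IH].
  by rewrite muln0 big_ord0 frobsum0 // /frobsum big_ord0.
rewrite mulnS addnC frobsum_split IH big_ord_recr /= frobsumD; congr (_ + _).
rewrite /frobsum exprp_sum; apply: eq_bigr => i _.
by rewrite -!exprM mulnC.
Qed.

End FrobeniusSums.

Section Trace.
Variables (K : finFieldType) (A : fieldExtType K).

Local Notation n := (\dim (fullv : {vspace A})).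
Local Notation q := #|K|.

Lemma expf_card_in_alg i (c : K) : (c%:A : A) ^+ (q ^ i) = c%:A.
Proof.
elim: i => [|i IH]; first by rewrite expr1.
by rewrite expnSr exprM IH -(in_algE A) -rmorphXn /= expf_card.
Qed.

Lemma expfD_card i (x y : A) : (x + y) ^+ (q ^ i) = x ^+ (q ^ i) + y ^+ (q ^ i).
Proof.
have [p p_pr hp] := finPcharP K.
have hA : p \in [pchar A] by rewrite (fmorph_pchar (in_alg A)).
have -> : q = (p ^ logn p #|K|)%N by exact: (card_pprimeChar hp).
by rewrite -expnM exprpDn.
Qed.

Lemma expf_sum_card i (I : Type) (r : seq I) (P : pred I) (E : I -> A) :
  (\sum_(j <- r | P j) E j) ^+ (q ^ i) = \sum_(j <- r | P j) E j ^+ (q ^ i).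
Proof.
apply: (big_morph (fun x => x ^+ (q ^ i)) (expfD_card i)).
by rewrite expr0n expn_eq0 -leqn0 leqNgt (ltn_trans _ (finNzRing_gt1 K)).
Qed.

(** The Moore matrix of the basis [vbasis fullv]. *)
Definition frobmx : 'M[A]_n := \matrix_(i, k) (vbasis fullv)`_i ^+ (q ^ k).

(* A vector in the kernel is the list of coefficients of an additive
   polynomial of degree less than #|A| that vanishes on all of A. *)
Lemma frobmx_unit : frobmx \in unitmx.
Proof.
rewrite -unitmx_tr -row_free_unit; apply: inj_row_free => v hv.
pose L : {poly A} := \sum_(k < n) v 0 k *: 'X^(q ^ k).
have q1 : (1 < q)%N := finNzRing_gt1 K.
have LE x : L.[x] = \sum_(k < n) v 0 k * x ^+ (q ^ k).
  by rewrite horner_sum; apply: eq_bigr => k _; rewrite hornerZ hornerXn.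
have Lb (i : 'I_n) : L.[(vbasis (fullv : {vspace A}))`_i] = 0.
  move/rowP/(_ i): hv; rewrite LE !mxE => hvi; rewrite -[RHS]hvi.
  by apply: eq_bigr => k _; rewrite !mxE.
have L0 x : L.[x] = 0.
  rewrite LE (coord_vbasis (memvf x)).
  under eq_bigr => k _ do rewrite expf_sum_card mulr_sumr.
  rewrite exchange_big /= big1 // => i _.
  transitivity ((coord (vbasis fullv) i x)%:A * L.[(vbasis (fullv : {vspace A}))`_i]).
    rewrite LE mulr_sumr; apply: eq_bigr => k _.
    rewrite -[X in X ^+ _]mulr_algl exprMn expf_card_in_alg; exact: mulrCA.
  by rewrite Lb mulr0.
have Lz : L = 0.
  apply/eqP/negPn/negP => Ln0.
  pose rs : seq A := enum (finvect_type A).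
  have cr : size rs = (q ^ n)%N.
    rewrite -[LHS](cardE (finvect_type A)).
    pose cvT := Vector.class (finvect_type A : vectType K).
    by rewrite -(@card_vspacef K (finvect_type A) cvT) card_vspace.
  have rsr : all (root L) rs by apply/allP => x _; apply/eqP/L0.
  have := max_poly_roots Ln0 rsr (enum_uniq (finvect_type A)).
  rewrite cr ltnNge; apply/negP; rewrite negbK.
  apply: leq_trans (size_sum _ _ _) _; apply/bigmax_leqP => k _.
  apply: leq_trans (size_scale_leq _ _) _; rewrite size_polyXn.
  by rewrite ltn_exp2l.
apply/rowP => k; rewrite mxE.
have <- : L`_(q ^ k) = v 0 k.
  rewrite coef_sum (bigD1 k) //= coefZ coefXn eqxx mulr1 big1 ?addr0 // => j jk.
  by rewrite coefZ coefXn eqn_exp2l // eq_sym (inj_eq val_inj) (negPf jk) mulr0.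
by rewrite Lz coef0.
Qed.

(** Multiplication by [a] expresses each [a * b_i] in the basis with coefficients in [K], which the
    [q ^ k]-th power map fixes. Raising these relations to the power [q ^ k] gives column [k]. *)
Lemma mulmx_frobmx (a : A) :
  map_mx (in_alg A) (passmx.mxof (vbasis fullv) (vbasis fullv) (amulr a))
    *m frobmx = frobmx *m diag_mx (\row_k a ^+ (q ^ k)).
Proof.
set b := vbasis fullv; set M := passmx.mxof _ _ _.
apply/matrixP => i k; rewrite mul_mx_diag !mxE.
transitivity ((\sum_j M i j *: b`_j) ^+ (q ^ k)).
  rewrite expf_sum_card; apply: eq_bigr => j _; rewrite !mxE /=.
  by rewrite -[in RHS]mulr_algl exprMn expf_card_in_alg.
rewrite -exprMn; congr (_ ^+ _).
transitivity (passmx.vecof b (delta_mx 0 i *m M)).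
  rewrite -rowE; apply: eq_bigr => j _; by rewrite [row _ _ _ _]mxE.
by rewrite passmx.mul_mxof passmx.rVofK ?vbasisP // passmx.vecof_delta lfunE.
Qed.

(** Conjugation by the Moore matrix preserves the trace and makes multiplication by [a] diagonal,
    with the conjugates of [a] as entries. *)
Lemma alg_trace_frobenius (a : A) :
  (alg_trace a)%:A = \sum_(i < n) a ^+ (q ^ i).
Proof.
rewrite /alg_trace; set M := passmx.mxof _ _ _.
rewrite -[LHS](trace_map_mx (in_alg A)).
have -> : map_mx (in_alg A) M
    = frobmx *m diag_mx (\row_k a ^+ (q ^ k)) *m invmx frobmx.
  by rewrite -mulmx_frobmx mulmxK ?frobmx_unit.
rewrite -mulmxA mxtrace_mulC mulmxKV ?frobmx_unit // mxtrace_diag.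
by apply: eq_bigr => i _; rewrite mxE.
Qed.

End Trace.

(** * Residues and the Hasse symbol *)

Section FractionFieldElements.
Variable F : finFieldType.
Implicit Types (x : ratfun F) (A B P : {poly F}).
Local Notation tofrac := (@FracField.tofrac {poly F}).

Lemma tofrac_repr x : x * tofrac (frac (repr x)).2 = tofrac (frac (repr x)).1.
Proof.
rewrite -{1}[x]reprK; set r := repr x.
apply/eqP; rewrite /= !piE /FracField.equivf /= /FracField.mulf.
have h := denom_ratioP r.
by rewrite !numden_Ratio ?oner_eq0 ?mulr1 // mulrC.
Qed.

Lemma ratfunE x : exists A B, B != 0 /\ x = tofrac A / tofrac B.
Proof.
exists (frac (repr x)).1, (frac (repr x)).2.
have h := denom_ratioP (repr x); split => //.
by rewrite -tofrac_repr mulfK // tofrac_eq0.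
Qed.

Lemma coprimep_fracnum_fracden x : coprimep (fracnum x) (fracden x).
Proof.
by rewrite coprimep_div_gcd // (denom_ratioP (repr x)) orbT.
Qed.

Lemma fracnumM A B : B != 0 ->
  fracnum (tofrac A / tofrac B) * B = A * fracden (tofrac A / tofrac B).
Proof.
move=> B0; set x := tofrac A / tofrac B; set r := repr x.
have d0 := denom_ratioP r.
have E : (frac r).1 * B = A * (frac r).2.
  apply/eqP; rewrite -tofrac_eq !rmorphM /= -tofrac_repr -/r mulrAC.
  by rewrite /x divfK // tofrac_eq0.
have g0 : gcdp (frac r).1 (frac r).2 != 0 by rewrite gcdp_eq0 negb_and d0 orbT.
apply: (mulfI g0); rewrite mulrA [_ * fracnum x]mulrC mulrCA [_ * fracden x]mulrC.
by rewrite !divpK ?dvdp_gcdl ?dvdp_gcdr.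
Qed.

(** [fracden] is coprime to [fracnum], so cross-multiplication forces its prime divisors into [B].
    Hence integrality and residues at [P] can be read off any fraction whose denominator is prime to
    [P]. *)
Lemma dvdp_fracden P A B : irreducible_poly P -> B != 0 ->
  P %| fracden (tofrac A / tofrac B) -> P %| B.
Proof.
move=> hP B0 hd; have := coprimep_fracnum_fracden (tofrac A / tofrac B).
move=> cop; have : P %| fracnum (tofrac A / tofrac B) * B.
  by rewrite fracnumM // dvdp_mull.
rewrite Gauss_dvdpr //; apply: coprimep_dvdr hd _; by rewrite coprimep_sym.
Qed.

Lemma ratfun_ord_ge0 P A B : irreducible_poly P -> ~~ (P %| B) ->
  (0 <= ratfun_ord P (tofrac A / tofrac B)%R)%E.
Proof.
move=> hP PB; rewrite /ratfun_ord; case: ifP => // _.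
suff -> : poly_ord P (fracden (tofrac A / tofrac B)) = 0%N by rewrite subr0 lee_fin.
have B0 : B != 0 by apply: contraNneq PB => ->; rewrite dvdp0.
apply/eqP; rewrite -leqn0; apply/bigmax_leqP => m hm.
rewrite leqNgt; apply/negP => m0; case/negP: PB.
apply: (dvdp_fracden hP B0); apply: dvdp_trans hm; exact: dvdp_exp.
Qed.

End FractionFieldElements.

Section ResidueField.
Variables (p : nat) (F : finFieldType) (hp : p \in [pchar F]).
Variables (P : {poly F}) (hP : monic_irreducible_poly P).
Local Notation E := {poly %/ P with hP}.
Local Notation tofrac := (@FracField.tofrac {poly F}).
Definition modP (f : {poly F}) : E := in_qpoly P f.

Let hP' : irreducible_poly P. Proof. by case: hP. Qed.

Lemma modPD f g : modP (f + g) = modP f + modP g. Proof. exact: in_qpolyD. Qed.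
Lemma modPM f g : modP (f * g) = modP f * modP g. Proof. exact: in_qpolyM. Qed.
Lemma modP0 : modP 0 = 0. Proof. exact: in_qpoly0. Qed.
Lemma modP1 : modP 1 = 1. Proof. exact: in_qpoly1. Qed.

HB.instance Definition _ := GRing.isNmodMorphism.Build {poly F} E modP (modP0, modPD).
HB.instance Definition _ := GRing.isMonoidMorphism.Build {poly F} E modP (modP1, modPM).

Lemma modP_eq0 f : (modP f == 0) = (P %| f).
Proof.
have hM : P \is monic by case: hP.
apply/eqP/idP => [/val_eqP /= | hD].
  by rewrite -Pdiv.IdomainMonic.modpE mk_monicE.
by apply/val_eqP; rewrite /= -Pdiv.IdomainMonic.modpE mk_monicE.
Qed.

Lemma modP_val (y : E) : modP (val y) = y.
Proof. by apply: val_inj; apply: in_qpoly_small; apply: size_mk_monic. Qed.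

Lemma pchar_residue_field : p \in [pchar E].
Proof. by rewrite (fmorph_pchar (in_alg E)). Qed.

Lemma card_residue_field : #|E| = (p ^ (logn p #|F| * (size P).-1))%N.
Proof. by rewrite card_qfpoly {1}(card_pprimeChar hp) expnM. Qed.

Lemma dim_residue_field : \dim (fullv : {vspace E}) = (size P).-1.
Proof.
apply/eqP; rewrite -(eqn_exp2l _ _ (finNzRing_gt1 F)) -card_qfpoly.
pose cvT := Vector.class (E : vectType F).
by rewrite -(@card_vspacef F E cvT) card_vspace.
Qed.

Lemma expf_residue_field (x : E) : x ^+ (p ^ (logn p #|F| * (size P).-1)) = x.
Proof. by rewrite -card_residue_field expf_card. Qed.

Lemma residue_tofrac A B : ~~ (P %| B) ->
  residue hP (tofrac A / tofrac B) = modP A / modP B.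
Proof.
move=> PB; have B0 : B != 0 by apply: contraNneq PB => ->; rewrite dvdp0.
rewrite /residue -/(modP _) -/(modP _).
apply/eqP; rewrite eqr_div ?modP_eq0 // -?rmorphM ?fracnumM //.
apply: contra PB; exact: dvdp_fracden.
Qed.

(** Each of the two traces is a sum of conjugates, and [frobsum_mul] composes them. *)
Lemma hasse_frobsum x :
  (hasse hp hP x)%:R = frobsum p (logn p #|F| * (size P).-1) (residue hP x) :> E.
Proof.
set r := residue hP x; pose t : F := alg_trace r.
have Et : t%:A = \sum_(i < (size P).-1) r ^+ (p ^ (logn p #|F| * i)) :> E.
  rewrite alg_trace_frobenius dim_residue_field; apply: eq_bigr => i _.
  by rewrite expnM -(card_pprimeChar hp).
have Eh : (hasse hp hP x)%:R = frobsum p (logn p #|F|) t.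
  have := alg_trace_frobenius (t : pPrimeCharType hp).
  rewrite pprimeChar_dimf card_Fp ?(pcharf_prime hp) // => e.
  by apply: etrans e; rewrite -[RHS]/((hasse hp hP x)%:R * 1) mulr1.
rewrite frobsum_mul ?pchar_residue_field // -Et -(in_algE E) -(rmorph_nat (in_alg E)).
rewrite Eh /frobsum rmorph_sum; apply: eq_bigr => i _.
by rewrite rmorphXn.
Qed.

Lemma natFp_inj : injective (fun c : 'F_p => c%:R : E).
Proof.
have p_pr := pcharf_prime hp; move=> c d /eqP /=.
wlog le_dc : c d / (d <= c)%N.
  by move=> H; case: (leqP d c) => [|/ltnW] h e; [|symmetry]; apply: H; rewrite // eq_sym.
rewrite -subr_eq0 -natrB // -(dvdn_pcharf pchar_residue_field) => h.
apply/val_inj/eqP; rewrite /= eqn_leq le_dc andbT -subn_eq0.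
move: h; apply: contraTT; rewrite -lt0n => h; apply/negP => /(dvdn_leq h).
apply/negP; rewrite -ltnNge; apply: leq_ltn_trans (leq_subr _ _) _.
by have := ltn_ord c; rewrite {2}Fp_cast.
Qed.

End ResidueField.

(** * Counting monic irreducible polynomials *)

Section MonicIrreducibles.
Variable F : finFieldType.
Implicit Types (P Q G V : {poly F}) (s : seq {poly F}).
Local Notation q := #|F|.
Local Notation mirr := (@monic_irreducible_poly F).

Lemma mirr_coprimep P Q : mirr P -> mirr Q -> P != Q -> coprimep P Q.
Proof.
move=> [hP mP] [hQ mQ]; apply: contraNT => nc.
have gP : gcdp P Q %= P by apply: hP (dvdp_gcdl _ _); rewrite -coprimep_def in nc *.
have gQ : gcdp P Q %= Q by apply: hQ (dvdp_gcdr _ _); rewrite -coprimep_def in nc *.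
rewrite -(eqp_monic mP mQ); apply: eqp_trans gQ; by rewrite eqp_sym.
Qed.

Lemma size_mirr_gt1 P : mirr P -> (1 < size P)%N.
Proof. by case=> -[]. Qed.

Lemma mirr_neq0 P : mirr P -> P != 0.
Proof. by case=> _ /monic_neq0. Qed.

Lemma prod_mirr_dvdp s G : uniq s -> (forall P, P \in s -> mirr P /\ P %| G) ->
  \prod_(P <- s) P %| G.
Proof.
elim: s => [|P s IH] /=; first by rewrite big_nil dvd1p.
case/andP => Ps us hs; rewrite big_cons Gauss_dvdp.
  rewrite (hs P _).2 ?mem_head // IH // => Q Qs; apply: hs.
  by rewrite inE Qs orbT.
have [hP _] := hs P (mem_head _ _).
rewrite coprimep_sym big_seq; apply: (big_ind (fun f => coprimep f P)) => [|f g|Q Qs].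
- exact: coprime1p.
- by rewrite coprimepMl => -> ->.
have [hQ _] := hs Q (mem_behead (Qs : Q \in behead (P :: s))).
by apply: mirr_coprimep => //; apply: contraNneq Ps => <-.
Qed.

Lemma size_prod_seq_sum s : (forall P, P \in s -> P != 0) ->
  size (\prod_(P <- s) P) = (\sum_(P <- s) (size P).-1).+1.
Proof.
elim: s => [|P s IH] hs; first by rewrite !big_nil size_poly1.
rewrite !big_cons size_mul ?(hs P (mem_head _ _)) //; last first.
  rewrite big_seq; apply: (big_ind (fun f => f != 0)) => [|f g f0 g0|Q Qs].
  - exact: oner_neq0.
  - by rewrite mulf_neq0.
  by rewrite hs // inE Qs orbT.
rewrite IH; last by move=> Q Qs; rewrite hs // inE Qs orbT.
have := hs P (mem_head _ _); rewrite -size_poly_gt0.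
by case: (size P) => // m _; rewrite addnS.
Qed.

Lemma sum_deg_mirr_leq s G : G != 0 -> uniq s ->
  (forall P, P \in s -> mirr P /\ P %| G) ->
  (\sum_(P <- s) (size P).-1 <= (size G).-1)%N.
Proof.
move=> G0 us hs; rewrite -ltnS -size_prod_seq_sum; last first.
  by move=> P /hs[/mirr_neq0].
rewrite (leq_trans (dvdp_leq G0 (prod_mirr_dvdp us hs))) //.
by rewrite prednK ?size_poly_gt0.
Qed.

Lemma irreducible_divisor V : (1 < size V)%N -> exists2 P, mirr P & P %| V.
Proof.
move: {2}(size V) (leqnn (size V)) => n; elim: n V => [|n IH] V.
  by rewrite leqn0 => /eqP ->.
move=> hn V1; have [irr|nirr] := pselect (irreducible_poly V).
  have V0 : lead_coef V != 0.
    by rewrite lead_coef_eq0 -size_poly_gt0 (ltn_trans _ V1).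
  exists ((lead_coef V)^-1 *: V); last by rewrite dvdpZl ?dvdpp ?invr_neq0.
  split; last by rewrite monicE lead_coefZ mulVf.
  split; first by rewrite size_scale ?invr_neq0.
  move=> Q Q1; rewrite dvdpZr ?invr_neq0 // => /(irr Q Q1).
  by move/eqp_trans; apply; rewrite eqp_sym eqp_scale ?invr_neq0.
have [Q [Q1 QV nQV]] : exists Q, [/\ size Q != 1%N, Q %| V & ~~ (Q %= V)].
  apply: contra_notP nirr => nQ; split => // Q Q1 QV; apply/negPn/negP => nQV.
  by apply: nQ; exists Q.
have V0 : V != 0 by rewrite -size_poly_gt0 (ltn_trans _ V1).
have Q0 : Q != 0 by apply: contraNneq V0 => Q0; rewrite Q0 dvd0p in QV.
have sQ : (size Q < size V)%N.
  by rewrite ltn_neqAle (dvdp_leq V0 QV) andbT; apply: contra nQV; rewrite -dvdp_size_eqp.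
have [||P hP PQ] := IH Q.
- by rewrite -ltnS (leq_trans sQ).
- by rewrite ltn_neqAle eq_sym Q1 size_poly_gt0.
by exists P => //; apply: dvdp_trans QV.
Qed.

Lemma card_exp_gt1 d : (0 < d)%N -> (1 < q ^ d)%N.
Proof. by move=> d0; have := ltn_exp2l 0 d (finNzRing_gt1 F); rewrite expn0 d0. Qed.

(** For [d > 0], the product of the monic irreducible polynomials whose degree divides [d]. *)
Definition frobpoly d : {poly F} := 'X^(q ^ d) - 'X.

Lemma size_frobpoly d : (0 < d)%N -> size (frobpoly d) = (q ^ d).+1.
Proof.
move=> d0; rewrite size_polyDl size_polyXn // size_polyN size_polyX ltnS.
exact: card_exp_gt1.
Qed.

Lemma frobpoly_neq0 d : (0 < d)%N -> frobpoly d != 0.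
Proof. by move=> d0; rewrite -size_poly_gt0 size_frobpoly. Qed.

Lemma mirr_dvd_frobpoly P : mirr P -> P %| frobpoly (size P).-1.
Proof.
move=> hP; rewrite -(modP_eq0 hP) rmorphB rmorphXn /= subr_eq0.
by rewrite -card_qfpoly expf_card.
Qed.

(** If the [q ^ N]-th power map fixes the class of ['X], it fixes the whole residue field, and so
    does the [q ^ r]-th power map with [r = N %% d]. For [r > 0], a polynomial of degree
    [q ^ r < q ^ d] would have [q ^ d] roots. *)
Lemma frobpoly_dvd P N : mirr P -> P %| frobpoly N -> ((size P).-1 %| N)%N.
Proof.
move=> hP; rewrite -(modP_eq0 hP) rmorphB rmorphXn /= subr_eq0 => /eqP hx.
set d := (size P).-1.
have d0 : (0 < d)%N by have := size_mirr_gt1 hP; rewrite /d; lia.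
have hN (y : {poly %/ P with hP}) : y ^+ (q ^ N) = y.
  have -> : y = \sum_(i < size (val y)) (val y)`_i *: modP hP 'X ^+ i.
    rewrite -[LHS](modP_val y) -[val y in LHS]coefK poly_def rmorph_sum /=; apply: eq_bigr => i _.
    by rewrite -rmorphXn /=; exact: in_qpolyZ.
  rewrite expf_sum_card; apply: eq_bigr => i _.
  by rewrite -[X in X ^+ _]mulr_algl exprMn expf_card_in_alg -exprM mulnC exprM hx mulr_algl.
have hd (y : {poly %/ P with hP}) k : y ^+ (q ^ (k * d)) = y.
  elim: k => [|k IH]; first by rewrite expr1.
  by rewrite mulSn expnD exprM -card_qfpoly expf_card IH.
have hr (y : {poly %/ P with hP}) : y ^+ (q ^ (N %% d)) = y.
  by rewrite -[RHS]hN {2}(divn_eq N d) expnD exprM hd.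
rewrite /dvdn -leqn0 leqNgt; apply/negP => r0.
pose L : {poly {poly %/ P with hP}} := 'X^(q ^ (N %% d)) - 'X.
have sL : size L = (q ^ (N %% d)).+1.
  rewrite size_polyDl size_polyXn // size_polyN size_polyX ltnS.
  exact: card_exp_gt1.
have L0 : L != 0 by rewrite -size_poly_gt0 sL.
have rL : all (root L) (enum {poly %/ P with hP}).
  by apply/allP => y _; rewrite /root !hornerE hr subrr.
have := max_poly_roots L0 rL (enum_uniq {poly %/ P with hP}).
rewrite sL -cardE card_qfpoly ltnS leq_exp2l ?finNzRing_gt1 // leqNgt.
by rewrite ltn_mod d0.
Qed.

(** The derivative of [frobpoly d] is [-1], because [q ^ d] is zero in [F]; a repeated factor would
    divide it. *)
Lemma frobpoly_squarefree P d : mirr P -> (0 < d)%N -> ~~ (P ^+ 2 %| frobpoly d).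
Proof.
move=> hP d0; apply/negP => /dvdpP[V EV].
have [r r_pr hr] := finPcharP F.
have q0 : (q ^ d)%:R = 0 :> F.
  apply/eqP; rewrite -(dvdn_pcharf hr) (card_pprimeChar hr) -expnM dvdn_exp //.
  rewrite muln_gt0 d0 andbT lt0n; apply: contraTneq (finNzRing_gt1 F) => e.
  by rewrite (card_pprimeChar hr) [logn _ _]e.
have := congr1 deriv EV; rewrite derivB derivXn derivX -mulr_natr -polyC_natr q0.
rewrite mulr0 sub0r expr2 mulrA derivM derivM => e.
have : P %| (- 1 : {poly F}).
  by rewrite e dvdp_add // ?dvdp_mulIr // mulrAC dvdp_mulIr.
by rewrite dvdpNr dvdp1 => /eqP h; have := size_mirr_gt1 hP; rewrite h.
Qed.

Definition polys_of_degree (T : set {poly F}) N : seq {poly F} :=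
  [seq val f | f <- enum [pred f : {poly_N.+1 F} | `[< T (val f) /\ size (val f) = N.+1 >]]].

Lemma polys_of_degree_uniq T N : uniq (polys_of_degree T N).
Proof. by rewrite map_inj_uniq ?enum_uniq //; exact: val_inj. Qed.

Lemma size_polys_of_degree T N : size (polys_of_degree T N) = count_deg T N.
Proof. by rewrite size_map -cardE. Qed.

Lemma polys_of_degreeP T N (f : {poly F}) :
  reflect (T f /\ size f = N.+1) (f \in polys_of_degree T N).
Proof.
apply: (iffP mapP) => [[g]|[Tf sf]]; first by rewrite mem_enum inE => hg ->.
have hf : f \is a poly_of_size N.+1 by rewrite qualifE /= sf.
by exists (NPoly hf) => //; rewrite mem_enum inE.
Qed.

(** Distinct monic irreducibles are coprime, so their product divides [G]. This is how one auxiliary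
    polynomial bounds a number of primes. *)
Lemma count_deg_bound T N G : G != 0 -> (T `<=` mirr)%classic ->
  (forall P, T P -> size P = N.+1 -> P %| G) -> (N * count_deg T N <= (size G).-1)%N.
Proof.
move=> G0 hT hG; apply: leq_trans (sum_deg_mirr_leq G0 (polys_of_degree_uniq T N) _).
  rewrite big_seq (eq_bigr (fun _ => N)) => [|P /polys_of_degreeP[_ ->] //].
  by rewrite -big_seq big_const_seq count_predT iter_addn_0 size_polys_of_degree.
by move=> P /polys_of_degreeP[TP sP]; split; [apply: hT | apply: hG].
Qed.

Lemma sum_expn_card M : (\sum_(1 <= d < M.+1) q ^ d <= q ^ M.+1)%N.
Proof.
have q1 := finNzRing_gt1 F.
elim: M => [|M IH]; first by rewrite big_geq.
rewrite big_nat_recr //= [leqRHS]expnS; apply: leq_trans (leq_add IH (leqnn _)) _.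
by rewrite addnn -mul2n leq_mul2r q1 orbT.
Qed.

(* Every irreducible divisor of the squarefree polynomial X^(q^N) - X has degree
   N, or degree at most N/2 and then divides the product of the X^(q^d) - X. *)
Lemma count_deg_mirr_ge N : (0 < N)%N ->
  (q ^ N <= N * count_deg mirr N + q ^ N./2.+1)%N.
Proof.
move=> N0; set M := N./2; have U0 := frobpoly_neq0 N0.
pose L := [seq val f | f <- enum [pred f : {poly_(q ^ N).+1 F} |
  `[< mirr (val f) /\ val f %| frobpoly N >]]].
have uL : uniq L by rewrite map_inj_uniq ?enum_uniq //; exact: val_inj.
have hL P : P \in L <-> mirr P /\ P %| frobpoly N.
  split=> [/mapP[g]|[hP PU]]; first by rewrite mem_enum inE => hg ->; exact: hg.
  have hf : P \is a poly_of_size (q ^ N).+1.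
    by rewrite qualifE /= -(size_frobpoly N0) dvdp_leq.
  by apply/mapP; exists (NPoly hf) => //; rewrite mem_enum inE.
have Lm P : P \in L -> mirr P by case/hL.
(* The cofactor [V] of the product is constant: an irreducible factor of [V] already occurs in the
   product, so its square would divide [frobpoly N]. *)
have EL : (q ^ N = \sum_(P <- L) (size P).-1)%N.
  have /dvdpP[V EV] := prod_mirr_dvdp uL (fun P h => (hL P).1 h).
  have V0 : V != 0 by apply: contraNneq U0 => V0; rewrite EV V0 mul0r.
  have [V1|V1] := ltnP 1 (size V); last first.
    have : size (frobpoly N) = size (\prod_(P <- L) P).
      have W0 : \prod_(P <- L) P != 0 by apply: contraNneq U0 => W0; rewrite EV W0 mulr0.
      by rewrite EV size_mul //; move: V1 V0; rewrite -size_poly_gt0; case: (size V) => [|[]].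
    by rewrite size_frobpoly // size_prod_seq_sum => [[]//|P /Lm/mirr_neq0].
  have [P hP PV] := irreducible_divisor V1.
  have PU : P %| frobpoly N by rewrite EV dvdp_mulr.
  case/negP: (frobpoly_squarefree hP N0); rewrite EV expr2 dvdp_mul //.
  by rewrite (big_rem P) /= ?dvdp_mulIl //; apply/hL.
rewrite {1}EL (bigID (fun P => (size P).-1 == N)) /= leq_add //.
  rewrite -big_filter big_seq (eq_bigr (fun _ => N)); last first.
    by move=> P; rewrite mem_filter => /andP[/eqP].
  rewrite -big_seq big_const_seq count_predT iter_addn_0 leq_mul2l.
  rewrite -size_polys_of_degree uniq_leq_size ?orbT ?filter_uniq // => P.
  rewrite mem_filter => /andP[/eqP sP /Lm hP]; apply/polys_of_degreeP; split=> //.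
  by rewrite -sP prednK // ltnW // size_mirr_gt1.
pose G := \prod_(1 <= d < M.+1) frobpoly d.
have G_neq0 m : \prod_(1 <= d < m.+1) frobpoly d != 0.
  rewrite big_nat_cond; apply: (big_ind (fun f => f != 0)).
  - exact: oner_neq0.
  - by move=> f g f0 g0; rewrite mulf_neq0.
  by move=> d; rewrite andbT => /andP[d0 _]; exact: frobpoly_neq0.
have G0 : G != 0 by exact: G_neq0.
have sG : (size G).-1 = (\sum_(1 <= d < M.+1) q ^ d)%N.
  rewrite /G; elim: (M) => [|m IH]; first by rewrite !big_geq // size_poly1.
  rewrite [in LHS]big_nat_recr // [in RHS]big_nat_recr //= size_mul ?frobpoly_neq0 ?G_neq0 //.
  rewrite size_frobpoly // addnS /= -IH; have := G_neq0 m.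
  by rewrite -size_poly_gt0; case: (size _).
rewrite -big_filter; apply: leq_trans (sum_deg_mirr_leq G0 _ _) _.
- by rewrite filter_uniq.
- move=> P; rewrite mem_filter => /andP[sP /hL[hP PU]]; split=> //.
  have PN := frobpoly_dvd hP PU; have P1 := size_mirr_gt1 hP.
  (* A divisor of [N] other than [N] is at most [N / 2]. *)
  have PM : ((size P).-1 <= M)%N.
    case/dvdnP: PN sP N0 => k; rewrite /M => ->; case: k => [|[|k]] //.
      by rewrite mul1n eqxx.
    move=> _ _; rewrite mulSn mulSn; move: (k * _)%N => kx; lia.
  rewrite /G (bigD1_seq (size P).-1) ?iota_uniq //=.
    by rewrite dvdp_mulr // mirr_dvd_frobpoly.
  by rewrite mem_index_iota ltnS PM andbT -ltnS prednK // ltnW.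
by rewrite sG sum_expn_card.
Qed.


(** Even multiplied by [N], the error [q ^ N./2.+1] is at most a constant times [q ^ N]. The
    relative error is thus O(1/N), the precision kept in all later estimates. *)
Lemma count_deg_mirr_lower N : (N * q ^ N <= N ^ 2 * count_deg mirr N + 2 * q * q ^ N)%N.
Proof.
case: N => // N; have q1 := finNzRing_gt1 F.
have := count_deg_mirr_ge (ltn0Sn N); set M := N.+1./2; set c := count_deg _ _ => h.
have hM : (N.+1 <= 2 * q ^ (N.+1 - M))%N.
  have hM2 : (N.+1 <= 2 * (N.+1 - M))%N.
    have := odd_double_half N.+1; rewrite -/M; case: odd; lia.
  by apply: leq_trans hM2 _; rewrite leq_mul2l ltnW // ltn_expl.
have hq : (N.+1 * q ^ M.+1 <= 2 * q * q ^ N.+1)%N.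
  have -> : (q ^ N.+1 = q ^ (N.+1 - M) * q ^ M)%N.
    by rewrite -expnD subnK // -leq_double; have := odd_double_half N.+1; rewrite -/M; lia.
  rewrite expnS mulnCA -mulnA [(2 * _)%N]mulnCA leq_mul2l; apply/orP; right.
  by rewrite mulnA leq_mul2r hM orbT.
apply: leq_trans (leq_mul (leqnn N.+1) h) _.
by rewrite mulnDr leq_add // expnS expn1 mulnA.
Qed.

End MonicIrreducibles.

(** * Stepanov's method *)

Section PolynomialSums.
Variable F : fieldType.
Implicit Types f g Q : {poly F}.

Lemma size_mul_leqS f g a b :
  (size f <= a.+1)%N -> (size g <= b.+1)%N -> (size (f * g)%R <= (a + b).+1)%N.
Proof.
move=> hf hg; apply: leq_trans (size_mul_leq f g) _.
by have := leq_add hf hg; rewrite addnS addSn; case: (_ + _)%N.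
Qed.

Lemma size_exp_leqS f a n : (size f <= a.+1)%N -> (size (f ^+ n) <= (a * n).+1)%N.
Proof.
move=> hf; elim: n => [|n IH]; first by rewrite size_poly1.
by rewrite exprS mulnS size_mul_leqS.
Qed.

(** The matrix of coefficients has more rows than columns, hence a nonzero left kernel. *)
Lemma linear_dependency (I : finType) (t : I -> {poly F}) n :
  (forall i, (size (t i) <= n)%N) -> (n < #|I|)%N ->
  exists2 x : I -> F, (exists i, x i != 0) & \sum_i x i *: t i = 0.
Proof.
move=> ht hn; pose M := \matrix_(i < #|I|, j < n) (t (enum_val i))`_j.
have : ~~ row_free M.
  by rewrite /row_free neq_ltn (leq_ltn_trans (rank_leq_col M)).
rewrite -kermx_eq0 => /rowV0Pn[u /sub_kermxP uM u0].
have [i ui] : exists i, u 0 i != 0.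
  apply/existsP; apply: contraNT u0; rewrite negb_exists => /forallP h.
  by apply/eqP/rowP => i; rewrite mxE; apply/eqP; move: (h i); rewrite negbK.
exists (fun i => u 0 (enum_rank i)); first by exists (enum_val i); rewrite enum_valK.
apply/polyP => j; rewrite coef0 coef_sum.
have [jn|jn] := ltnP j n; last first.
  by rewrite big1 // => l _; rewrite coefZ nth_default ?mulr0 // (leq_trans _ jn).
move/rowP/(_ (Ordinal jn)): uM; rewrite !mxE => h; apply: etrans h.
rewrite [RHS](reindex enum_rank) /=; last exact/onW_bij/enum_rank_bij.
by apply: eq_bigr => l _; rewrite coefZ !mxE enum_rankK.
Qed.

(** The leading term of the largest summand meets no other term of its degree. *)
Lemma size_sum_distinct (I : finType) (t : I -> {poly F}) :
  (exists i, t i != 0) ->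
  (forall i j, t i != 0 -> t j != 0 -> size (t i) = size (t j) -> i = j) ->
  exists2 i, t i != 0 & size (\sum_i t i) = size (t i).
Proof.
move=> [i0 ti0] ht.
case: (@arg_maxnP _ i0 xpredT (fun i => size (t i)) isT) => i _ hi'.
have {hi'} hi j : (size (t j) <= size (t i))%N by exact: hi'.
have ti : t i != 0 by rewrite -size_poly_gt0 (leq_trans _ (hi i0)) ?size_poly_gt0.
exists i => //; rewrite (bigD1 i) //= size_polyDl //.
rewrite -[X in (_ < X)%N]prednK ?size_poly_gt0 // ltnS.
apply: leq_trans (size_sum _ _ _) _; apply/bigmax_leqP => j ji.
have [->|tj] := eqVneq (t j) 0; first by rewrite size_poly0.
rewrite -ltnS prednK ?size_poly_gt0 // ltn_neqAle hi // andbT.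
by apply: contra ji => /eqP e; apply/eqP/ht.
Qed.

Lemma size_XnM_exp f m r : f != 0 -> size ('X^m * f ^+ r) = (m + (size f).-1 * r).+1.
Proof.
move=> f0; rewrite (size_mul (monic_neq0 (monicXn _ m)) (expf_neq0 r f0)).
rewrite size_polyXn addSn -size_exp /=.
by rewrite -addnS prednK // size_poly_gt0 expf_neq0.
Qed.

(** The degree of ['X^i * f ^+ r] is [i] modulo [r], and [i < s <= r]. *)
Lemma size_XnM_exp_inj (f g : {poly F}) (s r : nat) (i j : 'I_s) : (s <= r)%N ->
  f != 0 -> g != 0 -> size ('X^i * f ^+ r) = size ('X^j * g ^+ r) -> i = j.
Proof.
move=> sr f0 g0; rewrite !size_XnM_exp // => -[/(congr1 (modn^~ r))].
by rewrite /= !(addnC _ (_ * r)%N) !modnMDl !modn_small ?(leq_trans (ltn_ord _)) // => /val_inj.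
Qed.

Lemma size_sum_XnM_exp s r (c : 'I_s -> {poly F}) : (s <= r)%N ->
  (exists i, c i != 0) ->
  exists2 i : 'I_s, c i != 0 &
    size (\sum_(i < s) 'X^i * c i ^+ r) = (i + (size (c i)).-1 * r).+1.
Proof.
move=> sr [i0 ci0]; have X0 n : 'X^n != 0 :> {poly F} by rewrite -size_poly_gt0 size_polyXn.
have r0 : (0 < r)%N by apply: leq_trans sr; exact: leq_ltn_trans (ltn_ord i0).
have t0 (i : 'I_s) : ('X^i * c i ^+ r != 0) = (c i != 0).
  by rewrite mulf_eq0 negb_or X0 expf_eq0 r0.
have [|i j|i ti ->] := @size_sum_distinct _ (fun i : 'I_s => 'X^i * c i ^+ r).
- by exists i0; rewrite t0.
- by rewrite !t0 => ci cj; apply: size_XnM_exp_inj.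
by move: ti; rewrite t0 => ci; exists i; rewrite // size_XnM_exp.
Qed.

End PolynomialSums.

(** * Valuations at an irreducible polynomial *)

Section IrreducibleValuation.
Variables (F : fieldType) (p : nat).
Hypothesis hp : p \in [pchar F].
Variable Q : {poly F}.
Hypothesis hQ : irreducible_poly Q.
Implicit Types f g : {poly F}.

Lemma pchar_poly_eq : p \in [pchar {poly F}].
Proof. by rewrite pchar_poly. Qed.

Lemma irreducible_coprimep f : ~~ (Q %| f) -> coprimep Q f.
Proof.
apply: contraNT => nc; have [_ irr] := hQ.
by have := irr _ nc (dvdp_gcdl _ _); rewrite /eqp => /andP[_ /dvdp_trans]; apply; apply: dvdp_gcdr.
Qed.

Lemma irreducible_dvdpM f g : (Q %| f * g) = (Q %| f) || (Q %| g).
Proof.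
apply/idP/idP => [h|/orP[h|h]]; [|by rewrite dvdp_mulr|by rewrite dvdp_mull].
by have [//|/irreducible_coprimep c] := boolP (Q %| f); rewrite -(Gauss_dvdpr _ c).
Qed.

Lemma irreducible_dvdpX f n : Q %| f ^+ n -> Q %| f.
Proof.
elim: n => [|n IH]; first by rewrite dvdp1; case: hQ => + _; case: (size Q) => [|[]].
by rewrite exprS irreducible_dvdpM => /orP[].
Qed.

(** By additivity of [p ^ k]-th powers, the [c i] may be replaced by their remainders modulo [Q].
    The sum then has degree less than that of [Q ^+ (p ^ k)], so it is zero; as its nonzero terms
    would have distinct degrees, all remainders vanish. *)
Lemma dvdp_sum_XnM_exp s k (c : 'I_s -> {poly F}) : (s <= p ^ k)%N ->
  Q ^+ (p ^ k) %| \sum_(i < s) 'X^i * c i ^+ (p ^ k) -> forall i, Q %| c i.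
Proof.
move=> sr hd i0; set r := (p ^ k)%N in sr hd.
have Q1 : (1 < size Q)%N by case: hQ.
have Q0 : Q != 0 by rewrite -size_poly_gt0 ltnW.
pose d i := c i %% Q.
have {}hd : Q ^+ r %| \sum_(i < s) 'X^i * d i ^+ r.
  have e : \sum_(i < s) 'X^i * c i ^+ r =
     \sum_(i < s) 'X^i * d i ^+ r + Q ^+ r * (\sum_(i < s) 'X^i * (c i %/ Q) ^+ r).
    rewrite mulr_sumr -big_split /=; apply: eq_bigr => i _.
    rewrite {1}(divp_eq (c i) Q) (exprpDn pchar_poly_eq) exprMn.
    rewrite addrC mulrDr; congr (_ + _); by rewrite mulrA [RHS]mulrC.
  by move: hd; rewrite e dvdp_addl // dvdp_mulIl.
move: hd; apply: contraTT => di0.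
have [|i di sS] := @size_sum_XnM_exp _ s r d sr; first by exists i0.
have S0 : \sum_(i < s) 'X^i * d i ^+ r != 0 by rewrite -size_poly_gt0 sS.
apply/negP => /(dvdp_leq S0); apply/negP; rewrite -ltnNge sS.
rewrite -(prednK (_ : (0 < size (Q ^+ r))%N)) ?size_poly_gt0 ?expf_neq0 //.
rewrite ltnS size_exp.
have : ((size (d i)).-1 < (size Q).-1)%N.
  have h1 : (size (d i) < size Q)%N by rewrite ltn_modp.
  by move: h1 di; rewrite -size_poly_gt0; case: (size (d i)) => // a; case: (size Q).
move=> h; apply: (@leq_trans (((size (d i)).-1).+1 * r)); last by rewrite leq_mul2r h orbT.
by rewrite mulSn ltn_add2r (leq_trans (ltn_ord i)).
Qed.

Lemma exists_max_power (s : nat) (c : 'I_s -> {poly F}) : (exists i, c i != 0) ->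
  exists (w : nat) (c' : 'I_s -> {poly F}),
    (forall i, c i = Q ^+ w * c' i) /\ exists i, ~~ (Q %| c' i).
Proof.
move=> [i0]; move: {2}(size (c i0)) (leqnn (size (c i0))) => n.
elim: n c => [|n IH] c; first by rewrite leqn0 size_poly_eq0 => ->.
move=> sc ci0; have [|] := boolP [forall i, Q %| c i]; last first.
  rewrite negb_forall => /existsP[i hi]; exists 0%N, c; split; last by exists i.
  by move=> j; rewrite mul1r.
move/forallP => hd; have Q1 : (1 < size Q)%N by case: hQ.
have Q0 : Q != 0 by rewrite -size_poly_gt0 ltnW.
have [||w [c' [hc hi]]] := IH (fun i => c i %/ Q).
- rewrite size_divp //; move: sc Q1; case: (size Q) => [|[|m]] //= sc _.
  by rewrite leq_subLR (leq_trans sc) // addSn ltnS leq_addl.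
- by rewrite divpN0 // dvdp_leq.
exists w.+1, c'; split=> // i.
by rewrite exprSr mulrAC -hc divpK.
Qed.

(** With [Q ^+ w] the largest common power of [Q] in the [c i], [dvdp_sum_XnM_exp] bounds the
    remaining valuation by [p ^ k]. The point is that the valuation divided by [p ^ k] has integral
    part a multiple of [p]. *)
Lemma sum_XnM_exp_valuation s k (c : 'I_s -> {poly F}) : (s <= p ^ k)%N ->
  (exists i, c i != 0) ->
  exists w, Q ^+ (p ^ k * (p * w)) %| \sum_(i < s) 'X^i * c i ^+ (p ^ k.+1) /\
   ~~ (Q ^+ (p ^ k * (p * w).+1) %| \sum_(i < s) 'X^i * c i ^+ (p ^ k.+1)).
Proof.
move=> sk /exists_max_power[w [c' [hc [i ni]]]]; exists w.
have Q1 : (1 < size Q)%N by case: hQ.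
have Q0 : Q != 0 by rewrite -size_poly_gt0 ltnW.
have -> : \sum_(i < s) 'X^i * c i ^+ (p ^ k.+1) =
   Q ^+ (p ^ k * (p * w)) * \sum_(i < s) 'X^i * (c' i ^+ p) ^+ (p ^ k).
  rewrite mulr_sumr; apply: eq_bigr => j _; rewrite hc exprMn -!exprM -expnS.
  by rewrite mulrCA; congr (Q ^+ _ * _); rewrite mulnA -expnSr mulnC.
split; first exact: dvdp_mulIl.
rewrite mulnS addnC exprD dvdp_mul2l ?expf_neq0 //; apply: contra ni => hd.
exact: irreducible_dvdpX (dvdp_sum_XnM_exp sk hd i).
Qed.

(** Ultrametric argument: the nonzero term with least [l i] is not divisible by
    [Q ^+ (r * (l i).+1)], whereas all the others are. *)
Lemma sum_neq0_valuation (I : finType) (t : I -> {poly F}) (l : I -> nat) r :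
  (exists i, t i != 0) ->
  (forall i, t i != 0 -> Q ^+ (r * l i) %| t i /\ ~~ (Q ^+ (r * (l i).+1) %| t i)) ->
  (forall i j, t i != 0 -> t j != 0 -> l i = l j -> i = j) ->
  \sum_i t i != 0.
Proof.
move=> [i0 ti0] hl hinj.
case: (@arg_minnP _ i0 (fun i => t i != 0) l ti0) => i ti hi.
have [_] := hl i ti; apply: contraNneq; rewrite (bigD1 i) //= => /eqP.
rewrite addr_eq0 => /eqP ->; rewrite dvdpNr.
apply: (big_ind (fun f => Q ^+ (r * (l i).+1) %| f)) => [|f g|j ji].
- exact: dvdp0.
- exact: dvdp_add.
have [->|tj] := eqVneq (t j) 0; first exact: dvdp0.
have [+ _] := hl j tj; apply: dvdp_trans; apply: dvdp_exp2l.
rewrite leq_mul2l ltn_neqAle hi // andbT; apply/orP; right.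
by apply: contra ji => /eqP e; apply/eqP/hinj.
Qed.

End IrreducibleValuation.

(** * The auxiliary polynomial *)

Section Stepanov.
Variables (p : nat) (F : finFieldType) (hp : p \in [pchar F]).
Variables A B : {poly F}.
Local Notation mirr := (@monic_irreducible_poly F).

Let p_pr : prime p. Proof. exact: pcharf_prime hp. Qed.
Let p_gt0 : (0 < p)%N. Proof. exact: prime_gt0. Qed.
Let p_gt1 : (1 < p)%N. Proof. exact: prime_gt1. Qed.

(* The numerator of the truncated trace of A / B over the denominator B^(p^n). *)
Definition trace_num n : {poly F} := \sum_(i < n.+1) A ^+ (p ^ i) * B ^+ (p ^ n - p ^ i).

(** A polynomial of degree less than [p] in the partial trace [frobsum p k.+1 (A / B)], cleared of
    denominators by [B ^+ (p.-1 * p ^ k)]. Its coefficients involve [p ^ k.+1]-th powers so that a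
    further Frobenius power reduces them to the [b j m]. *)
Definition auxpoly k s (b : 'I_p -> 'I_s -> {poly F}) : {poly F} :=
  \sum_(j < p) (\sum_(m < s) 'X^m * b j m ^+ (p ^ k.+1)) *
    (trace_num k ^+ j * B ^+ ((p.-1 - j) * p ^ k)).

(* The p^(n+1)-st power of auxpoly modulo an irreducible polynomial of degree N,
   when p^(k+n+2) = #|F|^N and A / B has trace c. *)
Definition auxpoly_pow n s (b : 'I_p -> 'I_s -> {poly F}) (c : nat) : {poly F} :=
  \sum_(j < p) (\sum_(m < s) 'X^m ^+ (p ^ n.+1) * b j m) *
    ((c%:R * B ^+ (p ^ n) - trace_num n) ^+ j * B ^+ ((p.-1 - j) * p ^ n)).

Section Reduction.
Variables (P : {poly F}) (hP : mirr P).
Hypothesis PB : ~~ (P %| B).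
Local Notation E := {poly %/ P with hP}.
Local Notation red := (modP hP).
Let hE : p \in [pchar E]. Proof. exact: pchar_residue_field. Qed.
Let u : E := red A / red B.
Let B0 : red B != 0. Proof. by rewrite modP_eq0. Qed.

Lemma red_trace_num n : red (trace_num n) = frobsum p n.+1 u * red B ^+ (p ^ n).
Proof.
rewrite /trace_num rmorph_sum /frobsum mulr_suml; apply: eq_bigr => i _.
have le_in : (p ^ i <= p ^ n)%N by rewrite leq_exp2l // -ltnS.
rewrite rmorphM !rmorphXn /= /u expr_div_n -[in RHS](subnK le_in) exprD.
by rewrite [red B ^+ _ * _]mulrC mulrA divfK // expf_neq0.
Qed.

Lemma red_trace_term n (j : 'I_p) (x : E) :
  (x * red B ^+ (p ^ n)) ^+ j * red B ^+ ((p.-1 - j) * p ^ n)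
    = x ^+ j * red B ^+ (p.-1 * p ^ n).
Proof.
rewrite exprMn -exprM -mulrA -exprD mulnC -mulnDl; congr (_ * _ ^+ (_ * _)).
by rewrite subnKC // -ltnS prednK.
Qed.

(** Splitting the trace [c] gives [frobsum p k.+1 u = (c - y) ^+ (p ^ k.+1)], where [y] is the sum
    of the first [n + 1] conjugates. As [p ^ k.+1 * p ^ n.+1] is the order of the residue field, the
    power [p ^ n.+1] turns this partial trace into [c - y] and [b j m ^+ (p ^ k.+1)] into [b j m].
    Up to powers of [B], the result is [auxpoly_pow n b c]. *)
Lemma auxpoly_dvd k n s (b : 'I_p -> 'I_s -> {poly F}) (c : nat) :
  (logn p #|F| * (size P).-1 = k + n.+2)%N ->
  frobsum p (k + n.+2) u = c%:R -> auxpoly_pow n b c = 0 -> P %| auxpoly k b.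
Proof.
move=> hN hu hb; set y := frobsum p n.+1 u.
have hk : frobsum p k.+1 u = (c%:R - y) ^+ (p ^ k.+1).
  rewrite exprpDn // exprpN // exprp_nat // -hu -addSnnS frobsum_split //.
  by rewrite addrK.
pose S := \sum_(j < p) (\sum_(m < s) red 'X^m ^+ (p ^ n.+1) * red (b j m)) * (c%:R - y) ^+ j.
have S0 : S = 0.
  have := congr1 red hb; rewrite rmorph0 rmorph_sum /=.
  under eq_bigr => j _ do
    rewrite !rmorphM !rmorphXn rmorphB rmorphM rmorphXn rmorph_nat /= red_trace_num
      -mulrBl red_trace_term mulrA rmorph_sum.
  rewrite -mulr_suml => /eqP; rewrite mulf_eq0 expf_eq0 (negPf B0) andbF orbF => /eqP h.
  rewrite -[RHS]h; apply: eq_bigr => j _; congr (_ * _); apply: eq_bigr => m _.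
  by rewrite rmorphM rmorphXn.
rewrite -(modP_eq0 hP).
suff : red (auxpoly k b) ^+ (p ^ n.+1) = 0.
  by move/eqP; rewrite expf_eq0 => /andP[].
rewrite rmorph_sum /=.
under eq_bigr => j _ do
  rewrite !rmorphM !rmorphXn /= red_trace_num red_trace_term mulrA rmorph_sum hk.
rewrite -mulr_suml exprMn exprp_sum //.
apply/eqP; rewrite mulf_eq0; apply/orP; left; apply/eqP; apply: etrans S0.
rewrite /S.
apply: eq_bigr => j _.
have hE1 (x : E) : x ^+ (p ^ k.+1 * p ^ n.+1) = x.
  by rewrite -expnD addSnnS -hN expf_residue_field.
rewrite exprMn exprp_sum // [X in _ * X]exprAC -[X in _ * X ^+ _]exprM hE1; congr (_ * _).
apply: eq_bigr => m _; rewrite rmorphM [X in _ * X]rmorphXn /= exprMn.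
by rewrite -[X in _ * X]exprM hE1.
Qed.

End Reduction.

Variable d : nat.
Hypotheses (sA : (size A <= d.+1)%N) (sB : (size B <= d.+1)%N).

Lemma size_trace_num n : (size (trace_num n) <= (d * p ^ n).+1)%N.
Proof.
apply: leq_trans (size_sum _ _ _) _; apply/bigmax_leqP => i _.
have le_in : (p ^ i <= p ^ n)%N by rewrite leq_exp2l // -ltnS.
apply: leq_trans (size_mul_leqS (size_exp_leqS _ sA) (size_exp_leqS _ sB)) _.
by rewrite -mulnDr subnKC.
Qed.

Lemma size_trace_term n (V : {poly F}) (j : 'I_p) : (size V <= (d * p ^ n).+1)%N ->
  (size (V ^+ j * B ^+ ((p.-1 - j) * p ^ n))%R <= (p.-1 * (d * p ^ n)).+1)%N.
Proof.
move=> sV; apply: leq_trans (size_mul_leqS (size_exp_leqS _ sV) (size_exp_leqS _ sB)) _.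
rewrite ltnS [(_ * j)%N]mulnC [(d * (_ * _))%N]mulnCA -mulnDl subnKC //.
by rewrite -ltnS prednK.
Qed.

(** The dominant term [p ^ (k + n.+1)] is [q ^ N / p] when [p ^ (k + n.+2) = q ^ N]. *)
Lemma size_auxpoly k n s (b : 'I_p -> 'I_s -> {poly F}) :
  (forall j m, (size (b j m) <= (p ^ n).+1)%N) ->
  (size (auxpoly k b) <= (s + p ^ (k + n.+1) + p.-1 * (d * p ^ k)).+1)%N.
Proof.
move=> sb; apply: leq_trans (size_sum _ _ _) _; apply/bigmax_leqP => j _.
apply: size_mul_leqS (size_trace_term _ (size_trace_num k)).
apply: leq_trans (size_sum _ _ _) _; apply/bigmax_leqP => m _.
apply: leq_trans (size_mul_leqS _ (size_exp_leqS _ (sb j m))) _.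
- by rewrite size_polyXn ltnS; exact: ltnW (ltn_ord m).
by rewrite -expnD [(n + _)%N]addnC addSnnS.
Qed.

Lemma exists_auxpoly_pow_eq0 n c : let s := (p ^ n * d.+1).+1 in
  exists b : 'I_p -> 'I_s -> {poly F},
    [/\ exists j m, b j m != 0, forall j m, (size (b j m) <= (p ^ n).+1)%N
      & auxpoly_pow n b c = 0].
Proof.
move=> s; set L := (p ^ n).+1.
pose Y : {poly F} := c%:R * B ^+ (p ^ n) - trace_num n.
have sY : (size Y <= (d * p ^ n).+1)%N.
  apply: leq_trans (size_polyD _ _) _; rewrite size_polyN geq_max size_trace_num andbT.
  rewrite -polyC_natr mul_polyC (leq_trans (size_scale_leq _ _)) //.
  exact: size_exp_leqS.
(* The unknowns are the coefficients of the [b j m], and [t i] is the contribution of one of them to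
   [auxpoly_pow]. *)
pose t (i : 'I_p * 'I_s * 'I_L) : {poly F} :=
  'X^(i.1.2) ^+ (p ^ n.+1) * 'X^(i.2) * (Y ^+ i.1.1 * B ^+ ((p.-1 - i.1.1) * p ^ n)).
have [i||x [[[j m] e] xe] hx] := @linear_dependency F _ t
  (s.-1 * p ^ n.+1 + p ^ n + p.-1 * (d * p ^ n)).+1.
- apply: size_mul_leqS (size_trace_term _ sY); apply: size_mul_leqS.
    by rewrite -exprM size_polyXn ltnS leq_mul2r -ltnS ltn_ord orbT.
  by rewrite size_polyXn.
(* Unknowns and equations have the same leading term [p ^ n.+1 * (p ^ n * d.+1)]; the successors in
   [s] and [L] tip the balance in the lower-order terms. *)
- rewrite !card_prod !card_ord /s /L /= expnS; move: p_gt1.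
  case: (p) => [|[|r]] // _ /=; move: (r.+2 ^ n)%N => z.
  have -> : (r.+2 * (z * d.+1).+1 * z.+1 =
    (z * d.+1 * (r.+2 * z) + z + r.+1 * (d * z)).+2 + (z * d + 3 * z + r + r * (2 * z)))%N by ring.
  exact: leq_addr.
exists (fun j m => \sum_(e < L) x (j, m, e) *: 'X^e); split.
- exists j, m; apply: contraNneq xe => /(congr1 (fun f : {poly F} => f`_e)) /=.
  rewrite coef0 coef_sum (bigD1 e) //= coefZ coefXn eqxx mulr1 big1 ?addr0 => [->//|e' ee].
  by rewrite coefZ coefXn eq_sym (inj_eq val_inj) (negPf ee) mulr0.
- move=> j' m'; apply: leq_trans (size_sum _ _ _) _; apply/bigmax_leqP => e' _.
  by rewrite (leq_trans (size_scale_leq _ _)) // size_polyXn.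
transitivity (\sum_(j < p) \sum_(m < s) \sum_(e < L) x (j, m, e) *: t (j, m, e)).
  rewrite /auxpoly_pow -/Y; apply: eq_bigr => j' _.
  rewrite mulr_suml; apply: eq_bigr => m' _; rewrite mulr_sumr mulr_suml.
  apply: eq_bigr => e' _; by rewrite /t /= -scalerAr -scalerAl.
by rewrite pair_bigA pair_bigA -[RHS]hx; apply: eq_bigr => -[[]].
Qed.

(** A pole of [A / B] of order prime to [p], either at infinity with [B] constant or at an
    irreducible divisor [Q] of [B]. *)
Definition reduced_pole :=
  (size B = 1%N /\ ~~ (p %| (size A).-1)%N) \/
  exists (Q B' : {poly F}) e,
    [/\ irreducible_poly Q, B = Q ^+ e * B', ~~ (Q %| B'), ~~ (Q %| A) & ~~ (p %| e)%N].

Lemma eq_of_mulDmod e w1 w2 j1 j2 : ~~ (p %| e)%N -> (j1 < p)%N -> (j2 < p)%N ->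
  (p * w1 + j1 * e = p * w2 + j2 * e)%N -> j1 = j2.
Proof.
move=> pe h1 h2 /(congr1 (modn^~ p)) /= /eqP.
have cop : coprime p e by rewrite prime_coprime.
rewrite ![(p * _)%N]mulnC !modnMDl => h.
wlog le12 : j1 j2 h1 h2 h / (j1 <= j2)%N.
  by move=> H; case: (leqP j1 j2) => [|/ltnW] le; [|symmetry]; apply: H; rewrite // eq_sym.
apply/eqP; rewrite eqn_leq le12 /= -subn_eq0.
move: h; rewrite eq_sym eqn_mod_dvd ?leq_mul2r ?le12 ?orbT // -mulnBl.
rewrite Gauss_dvdl //; case: (j2 - j1)%N (leq_subr j1 j2) => // r hr.
by move/dvdn_leq => /(_ isT); rewrite leqNgt (leq_ltn_trans hr).
Qed.

(** The nonzero [j]-th summand has degree [(p * w + j * e) * p ^ k + m] with [m < p ^ k]. As [e] is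
    prime to [p] and [j < p], distinct [j] give distinct degrees. *)
Lemma auxpoly_neq0_infty k s (b : 'I_p -> 'I_s -> {poly F}) :
  size B = 1%N -> ~~ (p %| (size A).-1)%N -> (s <= p ^ k)%N ->
  (exists j m, b j m != 0) -> auxpoly k b != 0.
Proof.
move=> B1 pA sk [j0 [m0 b0]]; set e := (size A).-1 in pA.
have e0 : (0 < e)%N by rewrite lt0n; apply: contraNneq pA => ->; rewrite dvdn0.
have sAe : size A = e.+1 by move: e0; rewrite /e; case: (size A).
have B0 : B != 0 by rewrite -size_poly_gt0 B1.
have A0 : A != 0 by rewrite -size_poly_gt0 sAe.
have sBn n : size (B ^+ n) = 1%N.
  by rewrite -[LHS]prednK ?size_poly_gt0 ?expf_neq0 // size_exp B1.
have sAB i n : size (A ^+ i * B ^+ n) = (e * i).+1.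
  rewrite size_mul ?expf_neq0 // sBn addn1 /= -[LHS]prednK ?size_poly_gt0 ?expf_neq0 //.
  by rewrite size_exp.
have sV : size (trace_num k) = (e * p ^ k).+1.
  rewrite /trace_num big_ord_recr /= addrC size_polyDl sAB // ltnS.
  apply: leq_trans (size_sum _ _ _) _; apply/bigmax_leqP => i _; rewrite sAB.
  by rewrite ltn_pmul2l // ltn_exp2l.
have V0 : trace_num k != 0 by rewrite -size_poly_gt0 sV.
pose Phi (j : 'I_p) := \sum_(m < s) 'X^m * b j m ^+ (p ^ k.+1).
have sks : (s <= p ^ k.+1)%N by rewrite (leq_trans sk) // leq_exp2l.
have hPhi j : Phi j != 0 ->
    exists m : 'I_s, size (Phi j) = (m + (size (b j m)).-1 * p ^ k.+1).+1.
  move=> Pj; have [|m _ e1] := @size_sum_XnM_exp _ s _ (b j) sks; last by exists m.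
  apply/existsP; apply: contraNT Pj; rewrite negb_exists => /forallP h.
  rewrite /Phi big1 // => m _; move: (h m); rewrite negbK => /eqP ->.
  by rewrite expr0p ?pchar_poly_eq // mulr0.
pose t j := Phi j * (trace_num k ^+ j * B ^+ ((p.-1 - j) * p ^ k)).
have t0 j : (t j != 0) = (Phi j != 0).
  by rewrite mulf_eq0 negb_or mulf_neq0 ?expf_neq0 ?andbT.
have st j : t j != 0 -> exists m w, (m < p ^ k)%N /\
    size (t j) = ((p * w + j * e) * p ^ k + m).+1.
  rewrite t0 => Pj; have [m sP] := hPhi j Pj; exists m, (size (b j m)).-1.
  split; first exact: leq_trans sk.
  rewrite /t !size_mul ?mulf_neq0 ?expf_neq0 // sBn sP addn1 /=.
  rewrite -(prednK (_ : (0 < size (trace_num k ^+ j))%N)) ?size_poly_gt0 ?expf_neq0 //.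
  rewrite size_exp sV addnS /= expnS; ring.
have [|i j|i ti e1] := @size_sum_distinct _ _ t.
- exists j0; rewrite t0 -size_poly_gt0.
  by have [|m _ ->] := @size_sum_XnM_exp _ s _ (b j0) sks; first by exists m0.
- move=> /st[m1 [w1 [h1 ->]]] /st[m2 [w2 [h2 ->]]] [/(congr1 (fun x => x %/ (p ^ k)%N)%N)].
  rewrite /= !divnMDl ?expn_gt0 ?p_gt0 // !divn_small // !addn0.
  by move/(eq_of_mulDmod pA (ltn_ord i) (ltn_ord j))/val_inj.
by rewrite -size_poly_gt0 /auxpoly e1 size_poly_gt0.
Qed.

(** The same argument with the [Q]-adic valuation: divided by [p ^ k], that of a nonzero [j]-th
    summand has integral part [p * w + (p.-1 - j) * e]. *)
Lemma auxpoly_neq0_pole (Q B' : {poly F}) e k s (b : 'I_p -> 'I_s -> {poly F}) :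
  irreducible_poly Q -> B = Q ^+ e * B' -> ~~ (Q %| B') -> ~~ (Q %| A) ->
  ~~ (p %| e)%N -> (s <= p ^ k)%N ->
  (exists j m, b j m != 0) -> auxpoly k b != 0.
Proof.
move=> hQ EB QB QA pe sk [j0 [m0 b0]].
have Q0 : Q != 0 by case: hQ => Q1 _; rewrite -size_poly_gt0 ltnW.
have e0 : (0 < e)%N by rewrite lt0n; apply: contraNneq pe => ->; rewrite dvdn0.
have QB1 : Q %| B by rewrite EB dvdp_mulr // -(prednK e0) exprS dvdp_mulIl.
(* Every term of [trace_num k] contains a positive power of [B], except the last, which is
   [A ^+ (p ^ k)]. *)
have QV : ~~ (Q %| trace_num k).
  rewrite /trace_num big_ord_recr /= subnn expr0 mulr1 dvdp_addr.
    by apply: contra QA => /(irreducible_dvdpX hQ).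
  apply: (big_ind (fun f => Q %| f)) => [|f g|i _]; [exact: dvdp0|exact: dvdp_add|].
  have : (0 < p ^ k - p ^ i)%N by rewrite subn_gt0 ltn_exp2l.
  by case: (_ - _)%N => // r _; rewrite dvdp_mull // exprS dvdp_mulr.
pose Phi (j : 'I_p) := \sum_(m < s) 'X^m * b j m ^+ (p ^ k.+1).
pose U (j : 'I_p) := trace_num k ^+ j * B' ^+ ((p.-1 - j) * p ^ k).
have QU j : ~~ (Q %| U j).
  rewrite irreducible_dvdpM // negb_or.
  rewrite (contra (@irreducible_dvdpX _ _ hQ _ _) QV).
  by rewrite (contra (@irreducible_dvdpX _ _ hQ _ _) QB).
pose t j := Phi j * (trace_num k ^+ j * B ^+ ((p.-1 - j) * p ^ k)).
have tE j : t j = Q ^+ (p ^ k * ((p.-1 - j) * e)) * (Phi j * U j).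
  rewrite /t /U EB exprMn -exprM.
  have -> : (e * ((p.-1 - j) * p ^ k) = p ^ k * ((p.-1 - j) * e))%N by ring.
  by rewrite [trace_num k ^+ j * _]mulrCA [LHS]mulrCA.
have hw j : exists w, t j != 0 -> Q ^+ (p ^ k * (p * w)) %| Phi j /\
   ~~ (Q ^+ (p ^ k * (p * w).+1) %| Phi j).
  have [tj|] := boolP (t j != 0); last by exists 0%N.
  have [|w hw] := @sum_XnM_exp_valuation _ _ hp _ hQ s k (b j) sk; last by exists w.
  apply/existsP; apply: contraNT tj; rewrite negb_exists => /forallP h.
  rewrite /t /Phi big1 ?mul0r // => m _; move: (h m); rewrite negbK => /eqP ->.
  by rewrite expr0p ?pchar_poly_eq // mulr0.
have [w hw'] := choice hw.
apply: (@sum_neq0_valuation _ Q _ t (fun j => (p * w j + (p.-1 - j) * e)%N) (p ^ k)).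
- exists j0; have [|w0 [_ h]] := @sum_XnM_exp_valuation _ _ hp _ hQ s k (b j0) sk.
    by exists m0.
  have P0 : Phi j0 != 0 by apply: contraNneq h; rewrite /Phi => ->; rewrite dvdp0.
  have U0 : U j0 != 0 by apply: contraNneq (QU j0) => ->; rewrite dvdp0.
  by rewrite tE mulf_neq0 ?expf_neq0 // mulf_neq0.
- move=> j /hw'[h1 h2]; rewrite tE; split.
    by rewrite mulnDr addnC exprD dvdp_mul2l ?expf_neq0 // dvdp_mulr.
  rewrite -addSn mulnDr addnC exprD dvdp_mul2l ?expf_neq0 //.
  rewrite Gauss_dvdpl // coprimep_expl // irreducible_coprimep //.
move=> i j _ _ h; apply: val_inj.
have lt_r (l : 'I_p) : (p.-1 - l < p)%N.
  by rewrite -[X in (_ < X)%N](prednK p_gt0) ltnS leq_subr.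
have := eq_of_mulDmod pe (lt_r i) (lt_r j) h.
have := ltn_ord i; have := ltn_ord j; move: p_gt0 => /=; lia.
Qed.

Lemma auxpoly_neq0 k s (b : 'I_p -> 'I_s -> {poly F}) :
  reduced_pole -> (s <= p ^ k)%N -> (exists j m, b j m != 0) -> auxpoly k b != 0.
Proof.
case=> [[B1 pA]|[Q [B' [e [hQ EB QB QA pe]]]]].
  exact: auxpoly_neq0_infty.
exact: auxpoly_neq0_pole hQ EB QB QA pe.
Qed.

(** The size condition keeps the exponents of the ['X^m] below [p ^ k], as the nonvanishing argument
    demands. *)
Theorem stepanov_poly k n (c : nat) : reduced_pole -> ((p ^ n * d.+1).+1 <= p ^ k)%N ->
  exists G : {poly F}, [/\ G != 0,
    ((size G).-1 <= (p ^ n * d.+1).+1 + p ^ (k + n.+1) + p.-1 * (d * p ^ k))%N &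
    forall (P : {poly F}) (hP : mirr P), ~~ (P %| B) ->
      (logn p #|F| * (size P).-1 = k + n.+2)%N ->
      frobsum p (k + n.+2) (modP hP A / modP hP B) = c%:R -> P %| G].
Proof.
move=> red sk; have [b [b0 sb hb]] := exists_auxpoly_pow_eq0 n c.
exists (auxpoly k b); split; first exact: auxpoly_neq0.
- by have := size_auxpoly k sb; case: (size _).
- by move=> P hP PB hN hu; apply: (auxpoly_dvd PB hN hu hb).
Qed.

End Stepanov.

(** * Artin-Schreier reduction *)

Section Reduction.
Variables (p : nat) (F : finFieldType) (hp : p \in [pchar F]).
Local Notation tofrac := (@FracField.tofrac {poly F}).
Let p_pr : prime p. Proof. exact: pcharf_prime hp. Qed.
Let p_gt0 : (0 < p)%N. Proof. exact: prime_gt0. Qed.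
Let p_gt1 : (1 < p)%N. Proof. exact: prime_gt1. Qed.

Lemma pchar_ratfun : p \in [pchar ratfun F].
Proof.
have h := rmorph_pchar (polyC : {rmorphism F -> {poly F}}) hp.
exact: (rmorph_pchar (tofrac : {rmorphism {poly F} -> ratfun F}) h).
Qed.

Lemma artin_schreierD (x y : ratfun F) :
  (x + y) ^+ p - (x + y) = (x ^+ p - x) + (y ^+ p - y).
Proof. by rewrite -[p]expn1 exprpDn ?pchar_ratfun // opprD addrACA. Qed.

Lemma artin_schreierK (x y z : ratfun F) : x - y + (z - x + y) = z.
Proof.
have -> : z - x + y = z - (x - y) by rewrite opprB addrA addrAC.
by rewrite addrC subrK.
Qed.

Lemma finfield_pth_root (E : finFieldType) (x : E) : p \in [pchar E] ->
  exists y, y ^+ p = x.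
Proof.
move=> hE; exists (x ^+ (p ^ (logn p #|E|).-1)); rewrite -exprM -expnSr.
rewrite prednK -?(card_pprimeChar hE : #|E| = _)%N ?expf_card //.
rewrite lt0n; apply: contraTneq (finNzRing_gt1 E) => e.
by rewrite (card_pprimeChar hE) [logn _ _]e.
Qed.

(** The leading coefficient is a [p]-th power, so a leading term of degree [m * p] is removed by
    subtracting [(b *: 'X^m) ^+ p - b *: 'X^m]. The descent cannot reach a constant, by the
    hypothesis on [x]. *)
Lemma polynomial_reduction (x : ratfun F) n (A : {poly F}) g : (size A <= n)%N ->
  (forall h c, x <> h ^+ p - h + ratconst c) -> x = g ^+ p - g + tofrac A ->
  exists g' A', x = g' ^+ p - g' + tofrac A' /\ ~~ (p %| (size A').-1)%N.
Proof.
move=> + hx; elim: n A g => [|n IH] A g sA Ex.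
  case: (hx g 0); rewrite Ex /ratconst; congr (_ + tofrac _).
  by apply/eqP; move: sA; rewrite leqn0 size_poly_eq0.
have [s1|s1] := leqP (size A) 1.
  by case: (hx g A`_0); rewrite Ex /ratconst -size1_polyC.
have [/dvdnP[m Em]|pA] := boolP (p %| (size A).-1)%N; last by exists g, A.
have [b Eb] := finfield_pth_root (lead_coef A) hp.
have sAm : size A = (m * p).+1 by rewrite -Em prednK // ltnW.
have m0 : (0 < m)%N by rewrite lt0n; apply: contraTneq s1 => m0; rewrite sAm m0.
apply: (IH (A - (b *: 'X^m) ^+ p + b *: 'X^m) (g + tofrac (b *: 'X^m))); last first.
  by rewrite artin_schreierD Ex rmorphD rmorphB rmorphXn /= -[RHS]addrA artin_schreierK.
apply: leq_trans (size_polyD _ _) _; rewrite geq_max; apply/andP; split; last first.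
  rewrite (leq_trans (size_scale_leq _ _)) // size_polyXn -ltnS (leq_trans _ sA) // sAm ltnS.
  by rewrite ltn_Pmulr.
apply/leq_sizeP => j nj; have mj : (m * p <= j)%N.
  by rewrite -ltnS -sAm (leq_trans sA) //.
rewrite coefB exprZn coefZ -exprM coefXn Eb; case: eqVneq => [->|jn].
  by rewrite mulr1 lead_coefE sAm subrr.
by rewrite mulr0 subr0 nth_default // sAm ltn_neqAle eq_sym jn mj.
Qed.

Lemma irreducible_factorization (Q B : {poly F}) : irreducible_poly Q -> B != 0 ->
  exists e B', B = Q ^+ e * B' /\ ~~ (Q %| B').
Proof.
move=> hQ B0; have [|e [B' [hB [i hi]]]] := @exists_max_power _ Q hQ 1 (fun _ => B).
  by exists ord0.
by exists e, (B' i); rewrite -(hB i).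
Qed.

(** Descent on the denominator: a finite pole of order divisible by [p] can be lowered. Once the
    denominator is constant, [polynomial_reduction] treats the pole at infinity. *)
Theorem artin_schreier_reduction (x : ratfun F) :
  (forall h c, x <> h ^+ p - h + ratconst c) ->
  exists g A B, [/\ B != 0, x = g ^+ p - g + tofrac A / tofrac B & reduced_pole p A B].
Proof.
move=> hx; have [A0 [B0 [B00 Ex0]]] := ratfunE x.
suff H n : forall (A B : {poly F}) (g : ratfun F), (size B <= n)%N -> B != 0 ->
    x = g ^+ p - g + tofrac A / tofrac B ->
  exists g A B, [/\ B != 0, x = g ^+ p - g + tofrac A / tofrac B & reduced_pole p A B].
  apply: (H (size B0) A0 B0 0 (leqnn _) B00); rewrite expr0n (gtn_eqF p_gt0) subrr add0r.
  exact: Ex0.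
elim: n => [|n IH] A B g sB B0' Ex.
  by move: sB; rewrite leqn0 size_poly_eq0 (negPf B0').
have [s1|s1] := leqP (size B) 1.
  have [b Eb] : exists b, B = b%:P by exists B`_0; exact: size1_polyC.
  have b0 : b != 0 by apply: contraNneq B0' => b0; rewrite Eb b0.
  have tb0 : tofrac b%:P != 0 by rewrite tofrac_eq0 polyC_eq0.
  have e1 : tofrac A / tofrac b%:P = tofrac (b^-1 *: A).
    apply: (canLR (mulfK tb0)); rewrite -rmorphM /= mulrC mul_polyC scalerA (divff b0).
    rewrite scale1r; exact: erefl.
  rewrite Eb e1 in Ex.
  have [g' [A' [Ex' pA]]] := @polynomial_reduction x _ (b^-1 *: A) g (leqnn _) hx Ex.
  exists g', A', 1; split; first exact: oner_neq0.
    rewrite rmorph1 divr1; exact: Ex'.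
  by left; rewrite size_poly1.
have [Q hQ QB] := irreducible_divisor s1.
have irrQ : irreducible_poly Q by case: hQ.
have Q0 := mirr_neq0 hQ; have Q1 := size_mirr_gt1 hQ.
have [e [B' [EB QB']]] := irreducible_factorization irrQ B0'.
have B'0 : B' != 0 by apply: contraNneq QB' => ->; rewrite dvdp0.
have e0 : (0 < e)%N.
  by rewrite lt0n; apply: contraNneq QB' => e0; move: QB; rewrite EB e0 mul1r.
have tQ0 : tofrac Q != 0 by rewrite tofrac_eq0.
have tB0 : tofrac B != 0 by rewrite tofrac_eq0.
pose B1 := Q ^+ e.-1 * B'.
have EB1 : B = B1 * Q by rewrite EB /B1 mulrAC -exprSr prednK.
have B10 : B1 != 0 by rewrite mulf_neq0 ?expf_neq0.
have tB10 : tofrac B1 != 0 by rewrite tofrac_eq0.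
have sB1 : (size B1 <= n)%N.
  rewrite -ltnS (leq_trans _ sB) // EB1 (size_mul B10 Q0).
  by move: Q1; case: (size Q) => [|[|r]] // _; rewrite addnS /= addnS ltnS leq_addr.
have [/dvdpP[A1 EA]|QA] := boolP (Q %| A).
  apply: (IH A1 B1 g sB1 B10); rewrite Ex EA EB1 !rmorphM /= -mulf_div (divff tQ0) mulr1.
  exact: erefl.
have [/dvdnP[m Em]|pe] := boolP (p %| e)%N; last first.
  exists g, A, B; split; [exact: B0'|exact: Ex|].
  by right; exists Q, B', e.
have m0 : (0 < m)%N by rewrite lt0n; apply: contraTneq e0 => m0; rewrite Em m0.
have mp : (m <= e.-1)%N by rewrite -ltnS prednK // Em ltn_Pmulr.
(* The residue field is perfect, so the leading coefficient [A / B'] of the pole at [Q] is the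
   [p]-th power of some [h] modulo [Q]. *)
have [v Ev] := finfield_pth_root (modP hQ A / modP hQ B') (pchar_residue_field hp hQ).
pose h := val v.
have : Q %| A - h ^+ p * B'.
  rewrite -(modP_eq0 hQ) rmorphB rmorphM rmorphXn /= modP_val Ev divfK ?subrr //.
  by rewrite modP_eq0.
case/dvdpP => C EC.
(* Subtracting [(h / Q ^+ m) ^+ p] from [A / B] leaves [C / B1], and adding [h / Q ^+ m] keeps the
   denominator [B1] because [m <= e.-1]. *)
apply: (IH (C + h * B' * Q ^+ (e.-1 - m)) B1 (g + tofrac h / tofrac Q ^+ m) sB1 B10).
rewrite artin_schreierD Ex -[RHS]addrA; congr (_ + _); rewrite -[LHS](artin_schreierK
  ((tofrac h / tofrac Q ^+ m) ^+ p) (tofrac h / tofrac Q ^+ m)); congr (_ + _).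
rewrite rmorphD mulrDl; congr (_ + _).
  have -> : (tofrac h / tofrac Q ^+ m) ^+ p = tofrac (h ^+ p * B') / tofrac B.
    rewrite expr_div_n -exprM -Em EB !rmorphM !rmorphXn /= -mulf_div.
    rewrite (divff (_ : tofrac B' != 0)) ?mulr1; last by rewrite tofrac_eq0.
    exact: erefl.
  rewrite -mulrBl -rmorphB EC EB1 !rmorphM /= -mulf_div (divff tQ0) mulr1.
  exact: erefl.
apply/eqP; rewrite (eqr_div _ _ (expf_neq0 m tQ0) tB10); apply/eqP.
rewrite -rmorphXn -!rmorphM /=; congr tofrac.
rewrite /B1 -{1}(subnK mp) exprD; ring.
Qed.

End Reduction.

(** * From one linear combination to the density *)

Section LinearForms.
Variables (p l : nat) (p_pr : prime p).

(** If [v i0 != 0], the form takes every value [t], and translation by a preimage of [t] identifies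
    the fibres over 0 and [t]. The [p] fibres thus share the [p ^ l] vectors equally. *)
Lemma card_linear_form_eq0 (v : 'I_l -> 'F_p) :
  (p * #|[pred a : {ffun 'I_l -> 'F_p} | (\sum_i a i * v i == 0)%R]| =
   p ^ l + p.-1 * p ^ l * [forall i, v i == 0%R])%N.
Proof.
have cardT : #|{ffun 'I_l -> 'F_p}| = (p ^ l)%N by rewrite card_ffun card_Fp // card_ord.
have [/forallP v0|] := boolP [forall i, v i == 0].
  rewrite muln1 -mulSn prednK ?prime_gt0 // -cardT; congr (_ * _)%N.
  by apply: eq_card => a; rewrite !inE big1 // => i _; rewrite (eqP (v0 i)) mulr0.
rewrite negb_forall => /existsP[i0 vi0]; rewrite muln0 addn0.
pose phi (a : {ffun 'I_l -> 'F_p}) := \sum_i a i * v i.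
have fiber t : #|[pred a | phi a == t]| = #|[pred a | phi a == 0]|.
  pose s : {ffun 'I_l -> 'F_p} := [ffun i => if i == i0 then t / v i0 else 0].
  have phis : phi s = t.
    rewrite /phi (bigD1 i0) //= ffunE eqxx divfK // big1 ?addr0 // => i ii0.
    by rewrite ffunE (negPf ii0) mul0r.
  have phiD a : phi (s + a) = t + phi a.
    by rewrite -phis /phi -big_split /=; apply: eq_bigr => i _; rewrite ffunE mulrDl.
  rewrite -!sum1_card (reindex_inj (addrI s)) /=; apply: eq_bigl => a.
  by rewrite !inE phiD -{2}[t]addr0 (inj_eq (addrI t)).
rewrite -[RHS]cardT -[RHS]sum1_card (partition_big phi xpredT) //=.
rewrite (eq_bigr (fun=> #|[pred a | phi a == 0]|)) => [|t _].
  by rewrite sum_nat_const card_Fp.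
by rewrite sum1_card -(fiber t); apply: eq_card.
Qed.

End LinearForms.

(** * Constants in the geometric extension *)

Section GeometricExtension.
Variables (p : nat) (F : finFieldType) (hp : p \in [pchar F]).
Variables (l : nat) (D : 'I_l -> ratfun F).
Variables (K : fieldExtType (ratfun F)) (alpha : 'I_l -> K).
Hypothesis halpha : forall i, alpha i ^+ p - alpha i = (D i)%:A.
Hypothesis hgeom : geometric_ext K.

Let hk : p \in [pchar ratfun F]. Proof. exact: pchar_ratfun. Qed.
Let hK : p \in [pchar K]. Proof. by rewrite (fmorph_pchar (in_alg K)). Qed.

Definition constant_hom : {rmorphism F -> K} :=
  (in_alg K \o (@FracField.tofrac {poly F} \o polyC)).

Lemma constant_homE c : constant_hom c = constant_in K c.
Proof. by []. Qed.

Lemma exprpD1 (R : comNzRingType) (x y : R) : p \in [pchar R] ->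
  (x + y) ^+ p = x ^+ p + y ^+ p.
Proof. by move=> h; have := exprpDn h 1 x y; rewrite expn1. Qed.

(* The root of X^p - X - c in K given by the alpha i is a constant. *)
Lemma geometric_artin_schreier (a : 'I_l -> nat) g c :
  \sum_i (a i)%:R * D i = g ^+ p - g + ratconst c ->
  exists f, \sum_i (a i)%:R * D i = f ^+ p - f.
Proof.
move=> Ea; pose b : K := \sum_i (a i)%:R * alpha i - g%:A.
have Eb : b ^+ p - b = constant_hom c.
  rewrite constant_homE /constant_in.
  have -> : ratconst c = \sum_i (a i)%:R * D i - (g ^+ p - g).
    by rewrite Ea addrC addKr.
  rewrite -(in_algE K) rmorphB rmorphB rmorphXn rmorph_sum /=.
  have -> : \sum_i in_alg K ((a i)%:R * D i) =
      (\sum_i (a i)%:R * alpha i) ^+ p - \sum_i (a i)%:R * alpha i.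
    have := exprp_sum hK 1 (index_enum 'I_l) xpredT (fun i => (a i)%:R * alpha i).
    rewrite expn1 => ->; rewrite -sumrB; apply: eq_bigr => i _.
    have := exprp_nat hK 1 (a i); rewrite expn1 => en.
    by rewrite exprMn en -mulrBr halpha rmorphM rmorph_nat.
  rewrite /b exprpD1 //; have := exprpN hK 1 (g%:A); rewrite expn1 => ->.
  by rewrite opprD opprK addrACA; congr (_ + _); rewrite opprB addrC.
have [c' Ec'] : exists c' : F, b = constant_in K c'.
  apply: hgeom; exists ('X^p - 'X - c%:P).
    have p1 := prime_gt1 (pcharf_prime hp).
    rewrite -size_poly_gt0 -addrA size_polyDl size_polyXn //.
    apply: leq_ltn_trans (size_polyD _ _) _; rewrite gtn_max !size_polyN size_polyX.
    by rewrite !ltnS p1 (leq_trans (size_polyC_leq1 _)) // ltnW.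
  rewrite -(eq_map_poly constant_homE) rootE !rmorphB /= map_polyXn map_polyX map_polyC.
  by rewrite !hornerE /= Eb subrr.
(* Injectivity of [constant_hom] brings [c' ^+ p - c' = c] down to [F], so the constant is absorbed
   into [f]. *)
exists (g + ratconst c'); rewrite (artin_schreierD hp) Ea; congr (_ + _).
rewrite /ratconst -rmorphXn -rmorphB -rmorphXn -rmorphB; congr (FracField.tofrac _%:P).
apply: (fmorph_inj constant_hom); rewrite rmorphB rmorphXn -Eb.
by rewrite (constant_homE c') -Ec'.
Qed.

End GeometricExtension.

(** * Linearity of the symbol and counting by its values *)

Section HasseSymbol.
Variables (p : nat) (F : finFieldType) (hp : p \in [pchar F]).
Local Notation tofrac := (@FracField.tofrac {poly F}).
Local Notation mirr := (@monic_irreducible_poly F).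
Implicit Types (x y : ratfun F) (P : {poly F}).

(** Integrality at [P] witnessed by any fraction, reduced or not, which makes closure under sums and
    products immediate. *)
Definition regular P x :=
  exists A B : {poly F}, ~~ (P %| B) /\ x = tofrac A / tofrac B.

Lemma regular_large x : exists N0, forall P, (N0 < size P)%N -> regular P x.
Proof.
have [A [B [B0 Ex]]] := ratfunE x; exists (size B) => P sP; exists A, B; split=> //.
by apply: contraL sP => /(dvdp_leq B0); rewrite -leqNgt.
Qed.

Section AtPrime.
Variables (P : {poly F}) (hP : mirr P).
Local Notation E := {poly %/ P with hP}.
Let irr : irreducible_poly P. Proof. by case: hP. Qed.
Let hE : p \in [pchar E]. Proof. exact: pchar_residue_field. Qed.

Lemma tofrac_neq0 (B : {poly F}) : ~~ (P %| B) -> tofrac B != 0.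
Proof. by rewrite tofrac_eq0; apply: contraNneq => ->; rewrite dvdp0. Qed.

Lemma modP_neq0 (B : {poly F}) : ~~ (P %| B) -> modP hP B != 0.
Proof. by rewrite modP_eq0. Qed.

Lemma regularD x y : regular P x -> regular P y ->
  regular P (x + y) /\ residue hP (x + y) = residue hP x + residue hP y.
Proof.
move=> [A [B [PB ->]]] [A' [B' [PB' ->]]].
have PBB : ~~ (P %| B * B') by rewrite irreducible_dvdpM // negb_or PB.
have -> : tofrac A / tofrac B + tofrac A' / tofrac B' = tofrac (A * B' + A' * B) / tofrac (B * B').
  rewrite (addf_div _ _ (tofrac_neq0 PB) (tofrac_neq0 PB')) -!rmorphM -rmorphD; exact: erefl.
split; first by exists (A * B' + A' * B), (B * B').
rewrite !residue_tofrac // (addf_div _ _ (modP_neq0 PB) (modP_neq0 PB')).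
by rewrite -!rmorphM -rmorphD.
Qed.

Lemma regularM x y : regular P x -> regular P y ->
  regular P (x * y) /\ residue hP (x * y) = residue hP x * residue hP y.
Proof.
move=> [A [B [PB ->]]] [A' [B' [PB' ->]]].
have PBB : ~~ (P %| B * B') by rewrite irreducible_dvdpM // negb_or PB.
have -> : tofrac A / tofrac B * (tofrac A' / tofrac B') = tofrac (A * A') / tofrac (B * B').
  rewrite mulf_div -!rmorphM; exact: erefl.
split; first by exists (A * A'), (B * B').
by rewrite !residue_tofrac // mulf_div -!rmorphM.
Qed.

Lemma regular_poly (A : {poly F}) :
  regular P (tofrac A) /\ residue hP (tofrac A) = modP hP A.
Proof.
have P1 : ~~ (P %| 1) by rewrite dvdp1 gtn_eqF // (size_mirr_gt1 hP).
have e : tofrac A = tofrac A / tofrac 1 by rewrite rmorph1 divr1.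
rewrite e; split; first by exists A, 1.
by rewrite residue_tofrac // rmorph1 divr1.
Qed.

Lemma regular_sum l (a : 'I_l -> nat) (D : 'I_l -> ratfun F) :
  (forall i, regular P (D i)) -> regular P (\sum_i (a i)%:R * D i) /\
  residue hP (\sum_i (a i)%:R * D i) = \sum_i (a i)%:R * residue hP (D i).
Proof.
move=> hD; apply: (big_ind2 (fun (x : ratfun F) (y : E) => regular P x /\ residue hP x = y)).
- by have := regular_poly 0; rewrite !rmorph0.
- by move=> x1 y1 x2 y2 [h1 <-] [h2 <-]; apply: regularD.
move=> i _; have := regular_poly (a i)%:R; rewrite !rmorph_nat => -[h1 h2].
by have [h3 ->] := regularM h1 (hD i); rewrite h2.
Qed.

Lemma regular_exp x n : regular P x ->
  regular P (x ^+ n) /\ residue hP (x ^+ n) = residue hP x ^+ n.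
Proof.
move=> hx; elim: n => [|n [IH1 IH2]].
  by have := regular_poly 1; rewrite !rmorph1 !expr0.
by rewrite !exprS -IH2; apply: regularM.
Qed.

Lemma regularN x : regular P x -> regular P (- x) /\ residue hP (- x) = - residue hP x.
Proof.
move=> hx; have := regular_poly (-1); rewrite !rmorphN !rmorph1 => -[h1 h2].
by have [h3 h4] := regularM h1 hx; move: h3 h4; rewrite h2 !mulN1r.
Qed.

Lemma natFp_sum l (a v : 'I_l -> 'F_p) (s : 'F_p) : s = \sum_i a i * v i ->
  s%:R = \sum_i (a i)%:R * (v i)%:R :> E.
Proof.
have natE (c : 'F_p) : c%:R = in_alg (pPrimeCharType hE) c :> E.
  by rewrite -[RHS]/(c%:R * 1) mulr1.
move=> ->; apply: etrans (natE _) _; rewrite rmorph_sum; apply: eq_bigr => i _.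
by rewrite rmorphM; congr (_ * _); apply: esym; apply: natE.
Qed.

Lemma hasse_sum l (a : 'I_l -> 'F_p) (D : 'I_l -> ratfun F) :
  (forall i, regular P (D i)) ->
  hasse hp hP (\sum_i (a i)%:R * D i) = \sum_i a i * hasse hp hP (D i).
Proof.
move=> hD; apply: (natFp_inj hp (hP := hP)); rewrite hasse_frobsum.
have [_ ->] := regular_sum a hD; rewrite (natFp_sum (erefl _)) frobsum_sum //.
by apply: eq_bigr => i _; rewrite frobsum_natM // -hasse_frobsum.
Qed.

Lemma hasse_artin_schreier x : regular P x -> hasse hp hP (x ^+ p - x) = 0.
Proof.
move=> hx; apply: (natFp_inj hp (hP := hP)); rewrite hasse_frobsum.
have [h1 e1] := regular_exp p hx; have [h2 e2] := regularN hx.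
have [_ ->] := regularD h1 h2; rewrite e1 e2 frobsum_artin_schreier //.
by rewrite expf_residue_field // subrr.
Qed.

Lemma hasse_artin_schreierD x y : regular P x -> regular P y ->
  (hasse hp hP (x ^+ p - x + y))%:R =
  frobsum p (logn p #|F| * (size P).-1) (residue hP y) :> E.
Proof.
move=> hx hy; rewrite hasse_frobsum.
have [h1 e1] := regular_exp p hx; have [h2 e2] := regularN hx.
have [h3 e3] := regularD h1 h2; have [_ ->] := regularD h3 hy.
rewrite frobsumD // e3 e1 e2 frobsum_artin_schreier //.
by rewrite expf_residue_field // subrr add0r.
Qed.

Lemma regular_ord_ge0 x : regular P x -> (0 <= ratfun_ord P x)%E.
Proof. by move=> [A [B [PB ->]]]; apply: ratfun_ord_ge0. Qed.

End AtPrime.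

Definition hasse_set x (c : 'F_p) : set {poly F} :=
  [set P | exists hP : mirr P, hasse hp hP x = c]%classic.

Lemma hasse_setE x c P (hP : mirr P) : hasse_set x c P <-> hasse hp hP x = c.
Proof.
split=> [[hP' <-]|h]; last by exists hP.
by rewrite (Prop_irrelevance hP hP').
Qed.

Lemma count_deg_count (T : set {poly F}) N : (T `<=` mirr)%classic ->
  count_deg T N = count (fun P => `[< T P >]) (polys_of_degree mirr N).
Proof.
move=> hT; rewrite -size_polys_of_degree -size_filter; apply/perm_size/uniq_perm.
- exact: polys_of_degree_uniq.
- by rewrite filter_uniq ?polys_of_degree_uniq.
move=> P; rewrite mem_filter; apply/polys_of_degreeP/andP => [[TP sP]|[/asboolP TP]].
  by split; [apply/asboolP | apply/polys_of_degreeP; split=> //; apply: hT].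
by case/polys_of_degreeP.
Qed.

Lemma hasse_set_mirr x c : (hasse_set x c `<=` mirr)%classic.
Proof. by move=> P []. Qed.

Lemma sum_count_hasse_set x N :
  (\sum_(c : 'F_p) count_deg (hasse_set x c) N)%N = count_deg mirr N.
Proof.
under eq_bigr => c _ do rewrite (count_deg_count _ (@hasse_set_mirr x c)) -sum1_count big_mkcond.
rewrite exchange_big /= -size_polys_of_degree -sum1_size.
rewrite big_seq [RHS]big_seq; apply: eq_bigr => P /polys_of_degreeP[hP _].
rewrite (bigD1 (hasse hp hP x)) //= ifT; last by apply/asboolP/hasse_setE.
rewrite big1 // => c nc; rewrite ifF //; apply/asboolP => /(hasse_setE _ _ hP) e.
by rewrite e eqxx in nc.
Qed.

(** Double counting: after exchanging the sums over [a] and over [P], [card_linear_form_eq0] applies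
    to the symbols of the [D i] at [P]. For large [N] no prime of degree [N] is a pole of a
    [D i]. *)
Lemma sum_count_linear_form l (D : 'I_l -> ratfun F) :
  exists N0, forall N, (N0 <= N)%N ->
  (p * \sum_(a : {ffun 'I_l -> 'F_p}) count_deg (hasse_set (\sum_i (a i)%:R * D i)%R 0%R) N =
   p ^ l * count_deg mirr N + p.-1 * p ^ l * count_deg (zero_hasse_set D hp) N)%N.
Proof.
have [Nf hNf] := choice (fun i => regular_large (D i)).
exists (\max_i Nf i) => N hN; have p_pr := pcharf_prime hp.
have zm : (zero_hasse_set D hp `<=` mirr)%classic by move=> P [].
under eq_bigr => a _ do rewrite (count_deg_count _ (@hasse_set_mirr _ _)) -sum1_count big_mkcond.
rewrite exchange_big /=; have -> : count_deg (zero_hasse_set D hp) N =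
    (\sum_(P <- polys_of_degree mirr N) if `[< zero_hasse_set D hp P >] then 1 else 0)%N.
  by rewrite (count_deg_count _ zm) -sum1_count big_mkcond.
rewrite -size_polys_of_degree -sum1_size !big_distrr -big_split /=.
rewrite big_seq [RHS]big_seq; apply: eq_bigr => P /polys_of_degreeP[hP sP].
have reg i : regular P (D i) by apply: hNf; rewrite sP ltnS (leq_trans _ hN) // leq_bigmax.
have := card_linear_form_eq0 p_pr (fun i => hasse hp hP (D i)).
rewrite muln1 -big_mkcond sum1_card => e; transitivity (p * #|[pred a : {ffun 'I_l -> 'F_p} |
  (\sum_i a i * hasse hp hP (D i) == 0)%R]|)%N.
  congr (_ * _)%N; apply: eq_card => a; rewrite !inE -(hasse_sum hP a reg).
  by apply/asboolP/eqP => h; [apply/(hasse_setE _ _ hP) | apply/(hasse_setE _ _ hP)].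
rewrite e; congr (_ + _ * _)%N; case: forallP => [h|h]; last first.
  rewrite ifF //; apply/asboolP => -[hP' [_ h']]; apply: h => i.
  by rewrite (Prop_irrelevance hP hP') h'.
rewrite ifT //; apply/asboolP; exists hP; split=> i; last exact/eqP.
by apply: (regular_ord_ge0 hP).
Qed.

Lemma count_hasse_set_artin_schreier x f : x = f ^+ p - f ->
  exists N0, forall N, (N0 <= N)%N -> count_deg (hasse_set x 0) N = count_deg mirr N.
Proof.
move=> ->; have [N0 h0] := regular_large f; exists N0 => N hN.
rewrite (count_deg_count _ (@hasse_set_mirr _ _)) -size_polys_of_degree.
apply/eqP; rewrite -all_count; apply/allP => P /polys_of_degreeP[hP sP].
by apply/asboolP/(hasse_setE _ _ hP)/hasse_artin_schreier/h0; rewrite sP ltnS.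
Qed.

End HasseSymbol.

(** * Error estimates for a single combination *)

Section Asymptotics.
Variables (p : nat) (F : finFieldType) (hp : p \in [pchar F]).
Local Notation tofrac := (@FracField.tofrac {poly F}).
Local Notation mirr := (@monic_irreducible_poly F).
Local Notation q := #|F|.

Let p_pr : prime p. Proof. exact: pcharf_prime hp. Qed.
Let p_gt0 : (0 < p)%N. Proof. exact: prime_gt0. Qed.
Let p_gt1 : (1 < p)%N. Proof. exact: prime_gt1. Qed.

Lemma count_hasse_set_upper (x : ratfun F) :
  (forall h c, x <> h ^+ p - h + ratconst c) ->
  exists C N0, forall N (c : 'F_p), (N0 <= N)%N ->
    (p * N ^ 2 * count_deg (hasse_set hp x c) N <= (N + C) * q ^ N)%N.
Proof.
move=> hx; have [g [A [B [B0 Ex red]]]] := artin_schreier_reduction hp hx.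
have [Ng hg] := regular_large g.
pose d := maxn (size A) (size B); set f := logn p #|F|.
have qE : q = (p ^ f)%N by exact: (card_pprimeChar hp).
have f0 : (0 < f)%N.
  by rewrite lt0n; apply: contraTneq (finNzRing_gt1 F) => e; rewrite qE e.
exists (3 * d.+1)%N, (maxn Ng (3 * (d + 4))) => N c.
rewrite geq_max => /andP[NgN dN].
set M := (f * N)%N; have NM : (N <= M)%N by rewrite leq_pmull.
(* The growth of [n] makes [p ^ k] negligible against [p ^ M], while [k] must exceed [n + d] for the
   auxiliary polynomial to be nonzero. Taking a third of [M] satisfies both. *)
pose n := (M %/ 3)%N; pose k := (M - n - 2)%N.
have n3 : (3 * n <= M < 3 * n + 3)%N.
  by have := divn_eq M 3; have := ltn_mod M 3; rewrite -/n; lia.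
have kM : (k + n.+2 = M)%N by rewrite /k; lia.
have dk : (n + d + 2 <= k)%N by rewrite /k; lia.
have sk : ((p ^ n * d.+1).+1 <= p ^ k)%N.
  apply: (@leq_trans (p ^ (n + d + 2))); last by rewrite leq_exp2l.
  rewrite -addnA expnD; have := ltn_expl (d + 2) p_gt1.
  have : (0 < p ^ n)%N by rewrite expn_gt0 p_gt0.
  move: (p ^ n)%N (p ^ (d + 2))%N => a b; nia.
have sA : (size A <= d.+1)%N by rewrite ltnW // ltnS leq_maxl.
have sB : (size B <= d.+1)%N by rewrite ltnW // ltnS leq_maxr.
have [G [G0 sG hG]] := stepanov_poly hp sA sB (nat_of_ord c) red sk.
have bound : (N * count_deg (hasse_set hp x c) N <= (size G).-1)%N.
  apply: (count_deg_bound G0 (@hasse_set_mirr _ _ hp x c)) => P [hP hc] sP.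
  have PB : ~~ (P %| B).
    apply/negP => /(dvdp_leq B0); rewrite sP leqNgt => /negP; apply.
    by apply: leq_ltn_trans (leq_maxr (size A) _) _; rewrite -/d; lia.
  apply: (hG P hP PB); first by rewrite sP.
  have rg : regular P g by apply: hg; rewrite sP ltnS.
  have ry : regular P (tofrac A / tofrac B) by exists A, B.
  have := hasse_artin_schreierD hp hP rg ry; rewrite residue_tofrac // sP /= -Ex hc.
  by rewrite kM => ->.
have Q : (q ^ N = p ^ M)%N by rewrite qE -expnM.
have step : (p * (N * count_deg (hasse_set hp x c) N) <= p ^ M + d.+1 * p ^ (M - n))%N.
  apply: leq_trans (leq_mul (leqnn p) (leq_trans bound sG)) _.
  have E1 : (p ^ M = p * p ^ (k + n.+1))%N by rewrite -expnS -kM addnS.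
  have E2 : (p ^ (M - n) = p * (p * p ^ k))%N.
    by rewrite -!expnS; congr (_ ^ _)%N; rewrite /k; lia.
  rewrite E1 E2; move: sk; move: (p ^ n * d.+1).+1 (p ^ k)%N (p ^ (k + n.+1))%N => a b z ab.
  move: p_gt1; case: (p) => // r; rewrite /= ltnS => r0; nia.
rewrite Q; have -> : (p * N ^ 2 * count_deg (hasse_set hp x c) N =
   N * (p * (N * count_deg (hasse_set hp x c) N)))%N by rewrite expnS expn1; ring.
apply: leq_trans (leq_mul (leqnn N) step) _; rewrite mulnDr mulnDl leq_add2l.
have -> : (p ^ M = p ^ n * p ^ (M - n))%N by rewrite -expnD subnKC //; lia.
rewrite !mulnA leq_mul2r; apply/orP; right.
(* The factor [p ^ n] is at least [N / 3], since [N < 3 * n + 3] and [n < p ^ n]; hence the 3 in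
   [C]. *)
have := ltn_expl n p_gt1; move: (p ^ n)%N => z; nia.
Qed.

(* The density of [hasse_set x 0] is w / p, with the error term in O(1/N). *)
Definition has_weight (x : ratfun F) (w : nat) :=
  exists K N0, forall N, (N0 <= N)%N ->
    (N * p * count_deg (hasse_set hp x 0%R) N <= (N * w + K) * count_deg mirr N)%N /\
    (N * w * count_deg mirr N <= N * p * count_deg (hasse_set hp x 0%R) N
       + K * count_deg mirr N)%N.

Lemma has_weight_artin_schreier (x f : ratfun F) : x = f ^+ p - f -> has_weight x p.
Proof.
move=> /(count_hasse_set_artin_schreier hp)[N0 h]; exists 0%N, N0 => N /h ->.
by rewrite addn0 mul0n addn0.
Qed.

(** The upper estimate is [count_hasse_set_upper] for the value 0. The lower one subtracts from all
    primes the upper bounds for the other [p - 1] values. *)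
Lemma has_weight_generic (x : ratfun F) :
  (forall h c, x <> h ^+ p - h + ratconst c) -> has_weight x 1.
Proof.
move=> /count_hasse_set_upper[C [N1 hC]].
(* The error constant of [count_deg_mirr_lower]. *)
pose C' := (2 * q)%N.
(* The first condition serves the upper estimate, the second the lower one, where [p - 1] errors
   accumulate. *)
have [L hL1 hL2] : exists2 L, (C + C' <= L)%N & (p.-1 * (C + C') <= L)%N.
  by exists (C + C' + p.-1 * (C + C'))%N; rewrite ?leq_addr ?leq_addl.
exists (2 * L)%N, (N1 + 2 * C').+1 => N hN.
have N1N : (N1 <= N)%N by lia.
have C'N : (2 * C' <= N)%N by lia.
have N0 : (0 < N)%N by lia.
have low := count_deg_mirr_lower F N.
have tot := sum_count_hasse_set hp x N.
move: low tot; set pi := count_deg mirr N; set n := count_deg (hasse_set hp x 0%R) N.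
set Q := (q ^ N)%N => low tot.
have un : (p * N ^ 2 * n <= (N + C) * Q)%N by exact: hC.
have ur : (p * N ^ 2 * pi <= p * N ^ 2 * n + p.-1 * ((N + C) * Q))%N.
  rewrite -tot (bigD1 0%R) //= mulnDr leq_add2l big_distrr /=.
  apply: (@leq_trans (\sum_(c : 'F_p | c != 0%R) (N + C) * Q)).
    by apply: leq_sum => c _; exact: hC.
  rewrite sum_nat_const leq_mul2r; apply/orP; right.
  by rewrite (cardC1 (0 : 'F_p)) card_Fp.
(* For [N >= 2 * C'] the error is at most half of [N * Q]. This converts errors in [Q] into errors
   in [pi] and doubles the constant [L]. *)
have Qpi : (N * Q <= 2 * (N ^ 2 * pi))%N.
  have : (2 * C' * Q <= N * Q)%N by rewrite leq_mul2r C'N orbT.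
  move: low; rewrite /C'; move: (N * Q)%N (N ^ 2 * pi)%N => a b; rewrite -!mulnA; lia.
have LQ : (L * Q <= N * (2 * L * pi))%N.
  rewrite -(leq_pmul2l N0); have -> : (N * (L * Q) = L * (N * Q))%N by ring.
  have -> : (N * (N * (2 * L * pi)) = L * (2 * (N ^ 2 * pi)))%N by ring.
  by rewrite leq_mul2l Qpi orbT.
rewrite -/C' in low; split; rewrite -(leq_pmul2l N0).
  have -> : (N * (N * p * n) = p * N ^ 2 * n)%N by ring.
  have -> : (N * ((N * 1 + 2 * L) * pi) = N ^ 2 * pi + N * (2 * L * pi))%N by ring.
  apply: leq_trans un _.
  have : ((C + C') * Q <= L * Q)%N by rewrite leq_mul2r hL1 orbT.
  move: low LQ; rewrite !mulnDl; lia.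
have -> : (N * (N * 1 * pi) = N ^ 2 * pi)%N by ring.
have -> : (N * (N * p * n + 2 * L * pi) = p * N ^ 2 * n + N * (2 * L * pi))%N by ring.
have E : (p * N ^ 2 * pi = N ^ 2 * pi + p.-1 * (N ^ 2 * pi))%N.
  by rewrite -mulnA -{1}(prednK p_gt0) mulSn.
have : (p.-1 * ((N + C) * Q) <= p.-1 * (N ^ 2 * pi) + L * Q)%N.
  have -> : ((N + C) * Q = N * Q + C * Q)%N by rewrite mulnDl.
  apply: (@leq_trans (p.-1 * (N ^ 2 * pi + (C + C') * Q))).
    by rewrite leq_mul2l; apply/orP; right; move: low; rewrite mulnDl; lia.
  by rewrite mulnDr leq_add2l mulnA leq_mul2r hL2 orbT.
move: ur LQ; rewrite E; lia.
Qed.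

End Asymptotics.

(** Divided by [N * m * P N], the two bounds place [T N / P N] within [K / (N * m)] of [g / m]. *)
Lemma ratio_cvg (R : realType) (T P : nat -> nat) (g m K N0 : nat) : (0 < m)%N ->
  (forall N, (N0 <= N)%N -> (0 < P N)%N /\ (N * m * T N <= (N * g + K) * P N)%N /\
     (N * g * P N <= N * m * T N + K * P N)%N) ->
  ((T N)%:R / (P N)%:R @[N --> \oo] --> (g%:R / m%:R : R))%classic.
Proof.
move=> m0 h; apply/cvgrPdist_le => e e0; near=> N.
have [|P0 [h1 h2]] := h N; first by near: N; exact: nbhs_infty_ge.
have N1 : (0 < N)%N by near: N; exact: nbhs_infty_gt.
have KN : K%:R <= e * N%:R.
  rewrite mulrC -ler_pdivrMr //; near: N; exact: nbhs_infty_ger.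
have mR : 1 <= m%:R :> R by rewrite ler1n.
have PR : 0 < (P N)%:R :> R by rewrite ltr0n.
have NR : 0 < N%:R :> R by rewrite ltr0n.
have {h1} : (N%:R * m%:R * (T N)%:R <= (N%:R * g%:R + K%:R) * (P N)%:R :> R).
  by rewrite -!natrM -natrD -natrM ler_nat.
have {h2} : (N%:R * g%:R * (P N)%:R <= N%:R * m%:R * (T N)%:R + K%:R * (P N)%:R :> R).
  by rewrite -!natrM -natrD ler_nat.
move: mR PR NR KN; move: (N%:R) (P N)%:R (T N)%:R (m%:R) (K%:R) (g%:R) => n x t u k y.
move=> u1 x0 n0 kn h2 h1; have u0 : 0 < u by lra.
have -> : y / u - t / x = (n * y * x - n * u * t) / (n * u * x).
  by field; rewrite !gt_eqF.
have d0 : 0 < n * u * x by rewrite !mulr_gt0.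
have kx : k * x <= e * (n * u * x).
  have -> : e * (n * u * x) = (e * n) * x * u by ring.
  apply: (@le_trans _ _ (e * n * x)); first by rewrite ler_pM2r.
  by rewrite ler_peMr // ltW // !mulr_gt0.
rewrite ler_norml lerNl -mulNr !ler_pdivrMr //; apply/andP; split; lra.
Unshelve. all: by end_near. Qed.

(** * Summation over linear combinations *)

Section SumOfWeights.
Variables (p : nat) (F : finFieldType) (hp : p \in [pchar F]).
Local Notation mirr := (@monic_irreducible_poly F).

Lemma has_weight_sum (I : finType) (x : I -> ratfun F) (w : I -> nat) :
  (forall i, has_weight hp (x i) (w i)) ->
  exists K N0, forall N, (N0 <= N)%N ->
    (N * (p * \sum_i count_deg (hasse_set hp (x i) 0%R) N) <=
       (N * \sum_i w i + K) * count_deg mirr N)%N /\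
    (N * (\sum_i w i) * count_deg mirr N <=
       N * (p * \sum_i count_deg (hasse_set hp (x i) 0%R) N) + K * count_deg mirr N)%N.
Proof.
move=> /choice[K] /choice[N0 h]; exists (\sum_i K i)%N, (\max_i N0 i) => N hN.
have {}h i : _ := h i N (leq_trans (leq_bigmax i) hN).
split.
  rewrite mulnA big_distrr /= [in leqRHS]big_distrr -big_split /= big_distrl /=.
  by apply: leq_sum => i _; have [] := h i.
rewrite mulnA [in leqRHS]big_distrr /= [in leqLHS]big_distrr /= !big_distrl /= -big_split /=.
by apply: leq_sum => i _; have [] := h i.
Qed.

End SumOfWeights.

Theorem theorem3p4 (R : realType) (p : nat) (F : finFieldType)
    (hp : p \in [pchar F]) (l : nat) (D : 'I_l -> ratfun F)
    (hD : forall (i : 'I_l) (c : F), D i <> ratconst c)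
    (K : fieldExtType (ratfun F)) (alpha : 'I_l -> K)
    (halpha : forall i : 'I_l, alpha i ^+ p - alpha i = (D i)%:A)
    (hK : <<1 & codom alpha>>%VS = fullv)
    (hgeom : geometric_ext K) :
  relative_density (zero_hasse_set D hp)
    ((gammaS p D)%:R / (p ^ l)%:R : R).
Proof.
have p_pr := pcharf_prime hp; have p0 := prime_gt0 p_pr; have p1 := prime_gt1 p_pr.
pose A (a : {ffun 'I_l -> 'F_p}) : ratfun F := \sum_i (a i)%:R * D i.
pose is_as a := `[< exists f : ratfun F, A a = f ^+ p - f >].
(* In the second case geometricity also excludes the forms [g ^+ p - g + ratconst c], as the generic
   estimate demands. *)
have hw a : has_weight hp (A a) (if is_as a then p else 1%N).
  rewrite /is_as; case: asboolP => [[f hf]|nf].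
    exact: has_weight_artin_schreier hf.
  apply: has_weight_generic => g c Eg; apply: nf.
  exact: (geometric_artin_schreier hp halpha hgeom Eg).
have [K0 [N1 h1]] := has_weight_sum hw.
have [N2 h2] := sum_count_linear_form hp D.
(* Exactly [gammaS p D] of the [p ^ l] combinations have weight [p] instead of 1. *)
have EW : (\sum_a (if is_as a then p else 1) = p ^ l + p.-1 * gammaS p D)%N.
  have -> : gammaS p D = (\sum_(a | is_as a) 1)%N by rewrite sum1_card.
  rewrite big_distrr /= muln1 [X in (_ + X)%N]big_mkcond.
  have <- : #|{ffun 'I_l -> 'F_p}| = (p ^ l)%N by rewrite card_ffun card_Fp // card_ord.
  rewrite -sum1_card -big_split /=.
  by apply: eq_bigr => a _; case: ifP => _; rewrite ?addn0 // add1n prednK.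
rewrite /relative_density.
apply: (@ratio_cvg _ _ _ _ _ K0 (N1 + N2 + 2 * #|F|).+1); first by rewrite expn_gt0 p0.
move=> N hN; have N0 : (0 < N)%N by lia.
have [|a1 a2] := h1 N; first by lia.
have e := h2 N; rewrite e in a1 a2; last by lia.
rewrite EW in a1 a2.
(* For [N > 2 * q], [count_deg_mirr_lower] rules out a zero denominator. *)
have pi0 : (0 < count_deg (@monic_irreducible_poly F) N)%N.
  rewrite lt0n; apply/eqP => pi0; have := count_deg_mirr_lower F N.
  rewrite pi0 muln0 add0n leq_mul2r expn_eq0 [(N <= _)%N]leqNgt; have q1 := finNzRing_gt1 F.
  rewrite (_ : (2 * #|F| < N)%N) ?orbF; first by rewrite eqn0Ngt (ltnW q1).
  by apply: leq_trans hN; rewrite !ltnS leq_addl.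
split=> //.
(* On both sides the contribution of [p ^ l] times the number of primes cancels. The rest can be
   divided by [p - 1 >= 1] without enlarging [K0]. *)
move: a1 a2; set c := count_deg _ N; set t := count_deg _ N; set g := gammaS p D.
move: (p ^ l)%N => m; move: p1; case: (p) => [|[|r]] // _ /= a1 a2.
split; nia.
Qed.
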